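(* Let $G=\langle X\mid R\rangle$ be a torsion-free group that is $\delta$-negatively curved with respect to the finite generating set $X$. There exists an algorithm which, given a number $\mu$ and finite sets of words in $X$ generating subgroups $H$ and $K$ of $G$ that are $\mu$-quasiconvex in $G$, decides whether some non-trivial element of $H$ is conjugate in $G$ to an element of $K$, i.e. whether there exist $h\in H$ with $h\neq 1$ and $g\in G$ such that $ghg^{-1}\in K$.
   Context: Let $G=\langle X\mid R\rangle$ with $X$ finite, and let $X^*=\{x,x^{-1}: x\in X\}$. A word in $X$ is a finite sequence of elements of $X^*$. The Cayley graph of $G$ has vertex set $G$ and edge set $G\times X^*$, the edge $(g,x)$ going from $g$ to $gx$. A geodesic is a shortest path joining two vertices. A geodesic triangle is a closed path $p_1p_2p_3$ with each $p_i$ a geodesic. $G=\langle X\mid R\rangle$ is $\delta$-negatively curved if each side of every geodesic triangle in the Cayley graph belongs to the $\delta$-neighborhood of the union of the other two sides. A subgroup $H$ is $\mu$-quasiconvex in $G$ if every geodesic in the Cayley graph with endpoints in $H$ belongs to the $\mu$-neighborhood of $H$. Elements of $G$ are represented by words in $X$. *)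

(* Defs.v *)
From HB Require Import structures.
From mathcomp Require Import all_boot all_order all_algebra.
From mathcomp Require Import classical_sets reals.

Set Implicit Arguments.
Unset Strict Implicit.
Unset Printing Implicit Defensive.

Local Open Scope group_scope.
Local Open Scope classical_set_scope.

(* The alphabet X^*: (x, false) is the letter x, (x, true) the letter x^{-1}. *)
Definition letter (X : Type) : Type := (X * bool)%type.
Definition word (X : Type) : Type := seq (letter X).

Definition letter_inv (X : Type) (a : letter X) : letter X := (a.1, ~~ a.2).

(* The congruence on words whose quotient monoid is the group <X | rels>. *)
Inductive pres_eq (X : Type) (rels : set (word X)) : word X -> word X -> Prop :=
| pres_refl w : pres_eq rels w w
| pres_sym w1 w2 : pres_eq rels w1 w2 -> pres_eq rels w2 w1
| pres_trans w1 w2 w3 :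
    pres_eq rels w1 w2 -> pres_eq rels w2 w3 -> pres_eq rels w1 w3
| pres_cancel u a v : pres_eq rels (u ++ a :: letter_inv a :: v) (u ++ v)
| pres_rel u r v : rels r -> pres_eq rels (u ++ r ++ v) (u ++ v).

Definition letter_val (X : Type) (G : groupType) (gen : X -> G)
    (a : letter X) : G :=
  if a.2 then (gen a.1)^-1 else gen a.1.

Definition word_val (X : Type) (G : groupType) (gen : X -> G)
    (w : word X) : G :=
  \prod_(a <- w) letter_val gen a.

(* G = <X | rels>, the generator x being interpreted as gen x (the map gen
   need not be injective). *)
Definition is_presentation (X : Type) (G : groupType) (gen : X -> G)
    (rels : set (word X)) : Prop :=
  (forall g : G, exists w, word_val gen w = g) /\
  (forall w1 w2, word_val gen w1 = word_val gen w2 <-> pres_eq rels w1 w2).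

Definition torsion_free (G : groupType) : Prop :=
  forall (g : G) (n : nat), (0 < n)%N -> g ^+ n = 1 -> g = 1.

(* In the Cayley graph the edge (g, a) goes from g to g * a, so a path is
   determined by its initial vertex g and the word w labelling it. *)
Definition path_vertices (X : Type) (G : groupType) (gen : X -> G)
    (g : G) (w : word X) : seq G :=
  g :: scanl (fun h a => h * letter_val gen a) g w.

Definition path_end (X : Type) (G : groupType) (gen : X -> G)
    (g : G) (w : word X) : G :=
  last g (path_vertices gen g w).

Definition geodesic (X : Type) (G : groupType) (gen : X -> G)
    (g : G) (w : word X) : Prop :=
  forall w', path_end gen g w' = path_end gen g w -> (size w <= size w')%N.

(* Vertices at distance at most r from A. *)
Definition nbhd (X : Type) (G : groupType) (gen : X -> G) (R : realType)
    (r : R) (A : set G) : set G :=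
  [set g | exists w, A (path_end gen g w) /\ ((size w)%:R <= r)%R].

(* The sides of a geodesic triangle are the geodesics labelled w1, w2, w3
   that start at g1, g2, g3. *)
Definition negatively_curved (X : Type) (G : groupType) (gen : X -> G)
    (R : realType) (delta : R) : Prop :=
  forall (g1 g2 g3 : G) (w1 w2 w3 : word X),
    geodesic gen g1 w1 -> geodesic gen g2 w2 -> geodesic gen g3 w3 ->
    path_end gen g1 w1 = g2 -> path_end gen g2 w2 = g3 ->
    path_end gen g3 w3 = g1 ->
    let p1 := [set` path_vertices gen g1 w1] in
    let p2 := [set` path_vertices gen g2 w2] in
    let p3 := [set` path_vertices gen g3 w3] in
    [/\ p1 `<=` nbhd gen delta (p2 `|` p3),
        p2 `<=` nbhd gen delta (p1 `|` p3)
      & p3 `<=` nbhd gen delta (p1 `|` p2)].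

Definition quasiconvex (X : Type) (G : groupType) (gen : X -> G)
    (R : realType) (mu : R) (H : set G) : Prop :=
  forall (g : G) (w : word X), geodesic gen g w ->
    H g -> H (path_end gen g w) ->
    [set` path_vertices gen g w] `<=` nbhd gen mu H.

Definition is_subgroup (G : groupType) (H : set G) : Prop :=
  [/\ H 1, forall x y, H x -> H y -> H (x * y) & forall x, H x -> H x^-1].

Definition subgroup_gen (X : eqType) (G : groupType) (gen : X -> G)
    (A : seq (word X)) : set G :=
  smallest (@is_subgroup G)
    [set g | exists2 w, w \in A & word_val gen w = g].

(* Algorithms are Kleene's partial recursive functions of n arguments. *)
Inductive recfun : nat -> Type :=
| RZero : recfun 0
| RSucc : recfun 1
| RProj n : 'I_n -> recfun n
| RComp m n : recfun m -> ('I_m -> recfun n) -> recfun n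
| RPrec n : recfun n -> recfun n.+2 -> recfun n.+1
| RMin n : recfun n.+1 -> recfun n.

(* rec_eval f v y: the computation of f on v halts with output y.  In the case
   of primitive recursion, s lists the successive values; in the case of
   minimization, f must be defined and nonzero below y. *)
Fixpoint rec_eval n (f : recfun n) : n.-tuple nat -> nat -> Prop :=
  match f in recfun n return n.-tuple nat -> nat -> Prop with
  | RZero => fun _ y => y = 0%N
  | RSucc => fun v y => y = (thead v).+1
  | RProj n i => fun v y => y = tnth v i
  | RComp m n f gs => fun v y =>
      exists u : m.-tuple nat,
        (forall i, rec_eval (gs i) v (tnth u i)) /\ rec_eval f u y
  | RPrec n f g => fun v y =>
      let v' := [tuple of behead v] in
      exists s : nat -> nat,
        [/\ rec_eval f v' (s 0%N),
            forall k, (k < thead v)%N ->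
              rec_eval g [tuple of k :: s k :: v'] (s k.+1)
          & y = s (thead v)]
  | RMin n f => fun v y =>
      rec_eval f [tuple of y :: v] 0 /\
      forall k, (k < y)%N -> exists z, rec_eval f [tuple of k :: v] z.+1
  end.

(* Input coding by natural numbers; CodeSeq.code is the effective bijection of
   choice.v from finite sequences of naturals to naturals. *)
Definition letter_code (X : finType) (a : letter X) : nat :=
  ((enum_rank a.1).*2 + a.2)%N.

Definition word_code (X : finType) (w : word X) : nat :=
  CodeSeq.code [seq letter_code a | a <- w].

Definition words_code (X : finType) (A : seq (word X)) : nat :=
  CodeSeq.code [seq word_code w | w <- A].

(* Main.v *)
Require Import Defs.
From HB Require Import structures.
From mathcomp Require Import all_boot all_order all_algebra.
From mathcomp Require Import boolp classical_sets reals.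
From mathcomp Require Import zify.

(* Let d >= delta be an integer and let m = p >= mu = p/q.  All the geometry is
   done with the word metric, integer distances and slim triangles.

   Bounds.  If h in H has infinite order and g h g^-1 lies in K, then the
   powers of h make K and the coset g H come within 2m + 2d of each other, so
   g may be taken of length at most 2m + 2d.  For such a g, a pigeonhole
   argument along a geodesic from 1 to h shows that a shortest nontrivial h in
   H with g h g^-1 in K has computably bounded length.

   Membership.  It remains to decide membership in H for elements of bounded
   length.  Let S_t be the set of products of at most t generators of H that
   have length at most r.  Search for a t such that S_t is closed under inverses
   and under those products that stay in the ball, and is m-quasiconvex on a
   smaller ball.  Quasiconvexity of H implies that such a t exists.
   Conversely, for r large enough, such a local certificate propagates: every
   element of H is joined to 1 by a chain of S_t-steps that follows a
   geodesic, the width m + 2d of the chain being restored after every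
   multiplication by a generator.  Hence S_t contains every short element of H.

   Equality in G is decided by Dehn's algorithm with a finite table of shortest
   words, a closed path that is geodesic on the scale 4d + 2 being constant. *)

Set Implicit Arguments.
Unset Strict Implicit.
Unset Printing Implicit Defensive.

(** * Recursive functions *)

Definition recursive1 (F : nat -> nat) :=
  exists f : recfun 1, forall x, rec_eval f [tuple x] (F x).

Definition recursive2 (F : nat -> nat -> nat) :=
  exists f : recfun 2, forall x y, rec_eval f [tuple x; y] (F x y).

Definition recursive3 (F : nat -> nat -> nat -> nat) :=
  exists f : recfun 3, forall x y z, rec_eval f [tuple x; y; z] (F x y z).

Definition projn n k (lt_kn : k < n) : recfun n := RProj (Ordinal lt_kn).

Lemma rec_comp1 n (f : recfun 1) (g : recfun n) v x y :
  rec_eval g v x -> rec_eval f [tuple x] y ->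
  rec_eval (RComp f (fun=> g)) v y.
Proof.
by move=> gx fy; exists [tuple x]; split=> // -[[|//] lti]; rewrite (tnth_nth 0).
Qed.

Lemma rec_comp2 n (f : recfun 2) (g1 g2 : recfun n) v x1 x2 y :
  rec_eval g1 v x1 -> rec_eval g2 v x2 -> rec_eval f [tuple x1; x2] y ->
  rec_eval (RComp f (tnth [tuple g1; g2])) v y.
Proof.
move=> g1x g2x fy; exists [tuple x1; x2]; split=> //.
by case=> [[|[|//]] lti]; rewrite (tnth_nth 0) (tnth_nth g1).
Qed.

Lemma rec_proj n k (lt_kn : k < n) (v : n.-tuple nat) :
  rec_eval (projn lt_kn) v (nth 0 v k).
Proof. by rewrite /= (tnth_nth 0). Qed.

Lemma rec_const n c : exists f : recfun n, forall v, rec_eval f v c.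
Proof.
elim: c => [|c [f fE]].
  (* Composition with the empty family turns the nullary zero into an [n]-ary function. *)
  exists (RComp RZero (fun i : 'I_0 => match notF (ltn_ord i) with end)).
  by move=> v; exists [tuple]; split=> // -[].
by exists (RComp RSucc (fun=> f)) => v; apply: (rec_comp1 (fE v)).
Qed.

Lemma recursive2_comp F G H : recursive2 F -> recursive1 G -> recursive1 H ->
  recursive1 (fun x => F (G x) (H x)).
Proof.
move=> [f fE] [g gE] [h hE]; exists (RComp f (tnth [tuple g; h])) => x.
exact: rec_comp2 (gE x) (hE x) (fE _ _).
Qed.

Lemma recursive1_comp F G : recursive1 F -> recursive1 G ->
  recursive1 (fun x => F (G x)).
Proof.
by move=> [f fE] [g gE]; exists (RComp f (fun=> g)) => x; exact: rec_comp1 (gE x) _.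
Qed.

Lemma recursive12_comp F G : recursive1 F -> recursive2 G ->
  recursive2 (fun x y => F (G x y)).
Proof.
by move=> [f fE] [g gE]; exists (RComp f (fun=> g)) => x y; exact: rec_comp1 (gE _ _) _.
Qed.

Lemma recursive22_comp F G H : recursive2 F -> recursive2 G -> recursive2 H ->
  recursive2 (fun x y => F (G x y) (H x y)).
Proof.
move=> [f fE] [g gE] [h hE]; exists (RComp f (tnth [tuple g; h])) => x y.
exact: rec_comp2 (gE _ _) (hE _ _) (fE _ _).
Qed.

Lemma recursive23_comp F G H : recursive2 F -> recursive3 G -> recursive3 H ->
  recursive3 (fun x y z => F (G x y z) (H x y z)).
Proof.
move=> [f fE] [g gE] [h hE]; exists (RComp f (tnth [tuple g; h])) => x y z.
exact: rec_comp2 (gE _ _ _) (hE _ _ _) (fE _ _).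
Qed.

Lemma recursive1_id : recursive1 id.
Proof. by exists (@projn 1 0 isT) => x; exact: rec_proj. Qed.

Lemma recursive2_fst : recursive2 (fun x _ => x).
Proof. by exists (@projn 2 0 isT) => x y; exact: rec_proj. Qed.

Lemma recursive2_snd : recursive2 (fun _ y => y).
Proof. by exists (@projn 2 1 isT) => x y; exact: rec_proj. Qed.

Lemma recursive3_1 : recursive3 (fun x _ _ => x).
Proof. by exists (@projn 3 0 isT) => x y z; exact: rec_proj. Qed.

Lemma recursive3_2 : recursive3 (fun _ y _ => y).
Proof. by exists (@projn 3 1 isT) => x y z; exact: rec_proj. Qed.

Lemma recursive3_3 : recursive3 (fun _ _ z => z).
Proof. by exists (@projn 3 2 isT) => x y z; exact: rec_proj. Qed.

Lemma recursive1_const c : recursive1 (fun=> c).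
Proof. by have [f fE] := rec_const 1 c; exists f. Qed.

Lemma recursive2_const c : recursive2 (fun _ _ => c).
Proof. by have [f fE] := rec_const 2 c; exists f. Qed.

Lemma recursive1_succ : recursive1 succn.
Proof. by exists RSucc. Qed.

(* The recursion variable of RPrec comes first, the parameter last. *)
Lemma recursive2_prec (F : nat -> nat) (G : nat -> nat -> nat -> nat) :
  recursive1 F -> recursive3 G ->
  recursive2 (fun k x => nat_rect (fun=> nat) (F x) (fun i y => G i y x) k).
Proof.
move=> [f fE] [g gE]; exists (RPrec f g) => k x.
exists (fun k => nat_rect (fun=> nat) (F x) (fun i y => G i y x) k).
split=> //=.
  by have := fE x; congr (rec_eval f _ _); apply/val_inj.
move=> i _; have := gE i (nat_rect (fun=> nat) (F x) (fun i y => G i y x) i) x.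
by congr (rec_eval g _ _); apply/val_inj.
Qed.

Lemma recursive2_ext F G : (forall x y, F x y = G x y) -> recursive2 F -> recursive2 G.
Proof. by move=> eqFG [f fE]; exists f => x y; rewrite -eqFG. Qed.

Lemma recursive1_ext F G : F =1 G -> recursive1 F -> recursive1 G.
Proof. by move=> eqFG [f fE]; exists f => x; rewrite -eqFG. Qed.

Lemma recursive_swap F : recursive2 F -> recursive2 (fun x y => F y x).
Proof.
move=> Fr; exact: (recursive22_comp Fr recursive2_snd recursive2_fst).
Qed.

Lemma recursive3_unary2 F : recursive1 F -> recursive3 (fun _ y _ => F y).
Proof.
by move=> [f fE]; exists (RComp f (fun=> @projn 3 1 isT)) => x y z;
  apply: rec_comp1 (fE y); exact: rec_proj.
Qed.

(** * Arithmetic, minimization and pairing *)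

Lemma recursive_add : recursive2 addn.
Proof.
apply: recursive2_ext (recursive2_prec recursive1_id (recursive3_unary2 recursive1_succ)).
by move=> x y; elim: x => //= x ->.
Qed.

Lemma recursive_mul : recursive2 muln.
Proof.
have := recursive2_prec (recursive1_const 0)
  (recursive23_comp recursive_add recursive3_3 recursive3_2).
by apply: recursive2_ext => x y; elim: x => //= x ->.
Qed.

Lemma recursive_exp : recursive2 expn.
Proof.
have := recursive_swap (recursive2_prec (recursive1_const 1)
  (recursive23_comp recursive_mul recursive3_3 recursive3_2)).
by apply: recursive2_ext => x y; elim: y => //= y ->; rewrite expnS.
Qed.

Lemma recursive_pred : recursive1 predn.
Proof.
have /recursive2_comp-/(_ id id recursive1_id recursive1_id) :=
  recursive2_prec (recursive1_const 0) recursive3_1.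
by apply: recursive1_ext; case.
Qed.

Lemma recursive_sub : recursive2 subn.
Proof.
have := recursive_swap (recursive2_prec recursive1_id (recursive3_unary2 recursive_pred)).
by apply: recursive2_ext => x y; elim: y => [|y /= ->]; rewrite ?subn0 ?subnS.
Qed.

Lemma recursive_leq : recursive2 (fun x y => x <= y).
Proof.
have := recursive22_comp recursive_sub (recursive2_const 1) recursive_sub.
by apply: recursive2_ext => x y; rewrite /leq; case: (x - y).
Qed.

Lemma recursive_eq : recursive2 (fun x y => x == y).
Proof.
have := recursive22_comp recursive_mul recursive_leq (recursive_swap recursive_leq).
by apply: recursive2_ext => x y; rewrite eqn_leq mulnb.
Qed.

(** Minimization looks for a zero, hence the search on [1 - P]. The two hypotheses make [F x] the
    least solution, so all earlier values are nonzero. *)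
Lemma recursive1_min (P : nat -> nat -> bool) (F : nat -> nat) :
  recursive2 (fun y x => P y x) ->
  (forall x, P (F x) x) -> (forall x y, P y x -> F x <= y) ->
  recursive1 F.
Proof.
move=> Pr PF Fmin.
have [p pE] := recursive22_comp recursive_sub (recursive2_const 1) Pr.
exists (RMin p) => x /=; split; first by have := pE (F x) x; rewrite PF.
move=> k ltkF; exists 0; have := pE k x.
by case: (boolP (P k x)) => // /Fmin; rewrite leqNgt ltkF.
Qed.

(* natpair n (CodeSeq.code s) is CodeSeq.code (n :: s). *)
Definition natpair a b := 2 ^ a * b.*2.+1.
Definition natfst c := logn 2 c.
Definition natsnd c := (c %/ 2 ^ (natfst c).+1).

Lemma natpairK1 a b : natfst (natpair a b) = a.
Proof.
rewrite /natfst /natpair lognM ?expn_gt0 // pfactorK // logn_coprime ?addn0 //.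
by rewrite coprime2n /= odd_double.
Qed.

Lemma natpairK2 a b : natsnd (natpair a b) = b.
Proof.
rewrite /natsnd natpairK1 /natpair expnSr divnMA mulKn ?expn_gt0 //.
by rewrite -addn1 -mul2n mulnC divnMDl //= addn0.
Qed.

Lemma recursive_double : recursive1 double.
Proof.
by apply: recursive1_ext (recursive2_comp recursive_add recursive1_id recursive1_id) => x;
  rewrite addnn.
Qed.

Lemma recursive_natpair : recursive2 natpair.
Proof.
apply: (recursive22_comp recursive_mul).
  exact: recursive22_comp recursive_exp (recursive2_const 2) recursive2_fst.
apply: (recursive12_comp recursive1_succ (recursive12_comp recursive_double recursive2_snd)).
Qed.

Lemma recursive2_min (P : nat -> nat -> nat -> bool) (F : nat -> nat -> nat) :
  recursive3 (fun z x y => P z x y) ->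
  (forall x y, P (F x y) x y) -> (forall x y z, P z x y -> F x y <= z) ->
  recursive2 F.
Proof.
move=> Pr PF Fmin.
have [c cE] := rec_const 3 1.
have [p pE] := recursive23_comp recursive_sub (ex_intro _ c (fun x y z => cE _)) Pr.
exists (RMin p) => x y /=; split; first by have := pE (F x y) x y; rewrite PF.
move=> k ltkF; exists 0; have := pE k x y.
by case: (boolP (P k x y)) => // /Fmin; rewrite leqNgt ltkF.
Qed.

(* Multiplying the inequality by d makes the search succeed at 0 when d = 0,
   in accordance with x %/ 0 = 0. *)
Lemma recursive_div : recursive2 divn.
Proof.
apply: (@recursive2_min (fun q x d => d <= d * (q.+1 * d - x))).
- have m3 := recursive23_comp recursive_mul.
  apply: (recursive23_comp recursive_leq recursive3_3).
  apply: (m3 _ _ recursive3_3); apply: (recursive23_comp recursive_sub) recursive3_2.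
  apply: m3 recursive3_3.
  have [f fE] := recursive1_succ; exists (RComp f (fun=> @projn 3 0 isT)) => x y z.
  by apply: rec_comp1 (fE x); exact: rec_proj.
- move=> x [|d] //; rewrite leq_pmulr // subn_gt0 -ltn_divLR //.
- move=> x [|d] q //; rewrite -{1}[d.+1]muln1 leq_pmul2l // subn_gt0 -ltn_divLR //.
Qed.

Lemma recursive_natfst : recursive1 natfst.
Proof.
(* The test says that [2 ^ y.+1] does not divide [c]; the factor [c] makes it succeed at 0 when
   [c = 0], in accordance with [logn 2 0 = 0]. *)
have Pr : recursive2 (fun y c => (c %/ 2 ^ y.+1 * 2 ^ y.+1 == c) * c == 0).
  have pr : recursive2 (fun y _ => 2 ^ y.+1).
    apply: (recursive22_comp recursive_exp (recursive2_const 2)).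
    exact: recursive12_comp recursive1_succ recursive2_fst.
  apply: (recursive22_comp recursive_eq) (recursive2_const 0).
  apply: (recursive22_comp recursive_mul) recursive2_snd.
  apply: (recursive22_comp recursive_eq) recursive2_snd.
  apply: (recursive22_comp recursive_mul) (pr).
  exact: (recursive22_comp recursive_div recursive2_snd pr).
apply: (recursive1_min Pr) => [x|x y]; rewrite -dvdn_eq muln_eq0 eqb0;
  have [->|x_gt0] := posnP x; rewrite ?orbT ?orbF // /natfst pfactor_dvdn //; lia.
Qed.

Lemma recursive_natsnd : recursive1 natsnd.
Proof.
apply: (recursive2_comp recursive_div recursive1_id).
apply: (recursive2_comp recursive_exp (recursive1_const 2)).
exact: recursive1_comp recursive1_succ recursive_natfst.
Qed.

(** * Computable functions on coded data *)

(* No injectivity is required of en: computability only constrains the values of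
   a function on codes. *)
Class Enc (T : Type) := en : T -> nat.

Instance enc_nat : Enc nat := id.
Instance enc_bool : Enc bool := nat_of_bool.
Instance enc_prod A B {EA : Enc A} {EB : Enc B} : Enc (A * B) :=
  fun x => natpair (en x.1) (en x.2).
Instance enc_seq A {EA : Enc A} : Enc (seq A) := fun s => CodeSeq.code (map en s).

Definition computable {A B} {EA : Enc A} {EB : Enc B} (f : A -> B) : Prop :=
  exists2 F, recursive1 F & forall x, F (en x) = en (f x).

Section Computable.
Context {A B C : Type} {EA : Enc A} {EB : Enc B} {EC : Enc C}.

Lemma computable_ext (f g : A -> B) : f =1 g -> computable f -> computable g.
Proof. by move=> eqfg [F Fr FE]; exists F => // x; rewrite FE eqfg. Qed.

Lemma computable_id : computable (fun x : A => x).
Proof. by exists id; first exact: recursive1_id. Qed.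

Lemma computable_cst (c : B) : computable (fun=> c : B).
Proof. by exists (fun=> en c); first exact: recursive1_const. Qed.

Lemma computable_app (f : B -> C) (g : A -> B) :
  computable f -> computable g -> computable (fun x => f (g x)).
Proof.
move=> [F Fr FE] [G Gr GE]; exists (fun x => F (G x)); first exact: recursive1_comp.
by move=> x; rewrite GE FE.
Qed.

Lemma computable_pair (f : A -> B) (g : A -> C) :
  computable f -> computable g -> computable (fun x => (f x, g x)).
Proof.
move=> [F Fr FE] [G Gr GE]; exists (fun x => natpair (F x) (G x)).
  exact: recursive2_comp recursive_natpair Fr Gr.
by move=> x; rewrite FE GE.
Qed.

Lemma computable_fst (f : A -> B * C) : computable f -> computable (fun x => (f x).1).
Proof.
move=> [F Fr FE]; exists (fun x => natfst (F x)).
  exact: recursive1_comp recursive_natfst Fr.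
by move=> x; rewrite FE natpairK1.
Qed.

Lemma computable_snd (f : A -> B * C) : computable f -> computable (fun x => (f x).2).
Proof.
move=> [F Fr FE]; exists (fun x => natsnd (F x)).
  exact: recursive1_comp recursive_natsnd Fr.
by move=> x; rewrite FE natpairK2.
Qed.

Lemma computable_nat2 (F : nat -> nat -> nat) (f g : A -> nat) : recursive2 F ->
  computable f -> computable g -> computable (fun x => F (f x) (g x)).
Proof.
move=> Fr [f' f'r f'E] [g' g'r g'E]; exists (fun x => F (f' x) (g' x)).
  exact: recursive2_comp Fr f'r g'r.
by move=> x; rewrite f'E g'E.
Qed.

Lemma computable_rel2 (P : rel nat) (f g : A -> nat) :
  recursive2 (fun x y => P x y) ->
  computable f -> computable g -> computable (fun x => P (f x) (g x)).
Proof.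
move=> Fr [f' f'r f'E] [g' g'r g'E]; exists (fun x => P (f' x) (g' x) : nat).
  exact: recursive2_comp Fr f'r g'r.
by move=> x; rewrite f'E g'E.
Qed.

(** Both branches are total, so the conditional is an arithmetic combination of their values. *)
Lemma computable_if (b : A -> bool) (f g : A -> B) :
  computable b -> computable f -> computable g ->
  computable (fun x => if b x then f x else g x).
Proof.
move=> [b' b'r b'E] [f' f'r f'E] [g' g'r g'E].
exists (fun x => b' x * f' x + (1 - b' x) * g' x).
  apply: (recursive2_comp recursive_add); first exact: recursive2_comp recursive_mul _ _.
  apply: (recursive2_comp recursive_mul _ g'r).
  exact: recursive2_comp recursive_sub (recursive1_const 1) b'r.
by move=> x; rewrite b'E f'E g'E /en /=; case: (b x); rewrite /= !(mul1n, mul0n, addn0).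
Qed.

Lemma computable_iter (n : A -> nat) (z : A -> B) (s : A -> B -> B) :
  computable n -> computable z -> computable (fun p : A * B => s p.1 p.2) ->
  computable (fun x => iter (n x) (s x) (z x)).
Proof.
move=> [n' n'r n'E] [z' z'r z'E] [s' [sf sfE] s'E].
have Gr : recursive3 (fun _ y x => s' (natpair x y)).
  have [p pE] := recursive23_comp recursive_natpair recursive3_3 recursive3_2.
  by exists (RComp sf (fun=> p)) => i y x; exact: rec_comp1 (pE i y x) (sfE _).
exists (fun x => nat_rect (fun=> nat) (z' x) (fun i y => s' (natpair x y)) (n' x)).
  exact: recursive2_comp (recursive2_prec z'r Gr) n'r recursive1_id.
move=> x; rewrite n'E; have -> : en (n x) = n x by [].
by elim: (n x) => //= k ->; rewrite -[in RHS](s'E (x, _)).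
Qed.

Lemma computable_cons (f : A -> B) (g : A -> seq B) :
  computable f -> computable g -> computable (fun x => f x :: g x).
Proof.
move=> [F Fr FE] [G Gr GE]; exists (fun x => natpair (F x) (G x)).
  exact: recursive2_comp recursive_natpair Fr Gr.
by move=> x; rewrite FE GE.
Qed.

(** The empty sequence has code 0 and [b :: r] has the positive code [natpair (en b) (en r)]. So a
    zero test separates the cases, and the code of [b :: r] is already that of the pair [(b, r)]. *)
Lemma computable_seq_case (l : A -> seq B) (f : A -> C) (g : A -> B -> seq B -> C) :
  computable l -> computable f -> computable (fun p : A * (B * seq B) => g p.1 p.2.1 p.2.2) ->
  computable (fun x => if l x is b :: r then g x b r else f x).
Proof.
move=> [l' l'r l'E] [f' f'r f'E] [g' g'r g'E].
exists (fun x => (l' x == 0) * f' x + (1 - (l' x == 0)) * g' (natpair x (l' x))).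
  have er : recursive1 (fun x => l' x == 0).
    exact: recursive2_comp recursive_eq l'r (recursive1_const 0).
  apply: (recursive2_comp recursive_add); first exact: recursive2_comp recursive_mul _ _.
  apply: (recursive2_comp recursive_mul).
    exact: recursive2_comp recursive_sub (recursive1_const 1) er.
  apply: (recursive1_comp g'r).
  exact: recursive2_comp recursive_natpair recursive1_id l'r.
move=> x; rewrite l'E f'E; case: (l x) => [|b r]; first by rewrite !(mul1n, mul0n, addn0).
have -> : (en (b :: r) == 0) = false by rewrite /en /= muln_eq0 expn_eq0.
by rewrite !(mul1n, mul0n, add0n); exact: (g'E (x, (b, r))).
Qed.

End Computable.

Section ComputableApp.
Context {A B C D E : Type} {EA : Enc A} {EB : Enc B} {EC : Enc C} {ED : Enc D} {EE : Enc E}.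

Lemma computable_app2 (h : B -> C -> E) (f : A -> B) (g : A -> C) :
  computable (fun p : B * C => h p.1 p.2) -> computable f -> computable g ->
  computable (fun x => h (f x) (g x)).
Proof. by move=> ch cf cg; exact: (computable_app ch (computable_pair cf cg)). Qed.

Lemma computable_app3 (h : B -> C -> D -> E) (f1 : A -> B) (f2 : A -> C) (f3 : A -> D) :
  computable (fun p : B * (C * D) => h p.1 p.2.1 p.2.2) ->
  computable f1 -> computable f2 -> computable f3 ->
  computable (fun x => h (f1 x) (f2 x) (f3 x)).
Proof.
move=> ch c1 c2 c3.
exact: (computable_app ch (computable_pair c1 (computable_pair c2 c3))).
Qed.

End ComputableApp.

Lemma size_code s : size s <= CodeSeq.code s.
Proof.
elim: s => //= n s IHs; have : 0 < 2 ^ n by rewrite expn_gt0.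
by nia.
Qed.

Section ComputableFoldl.
Context {A B C : Type} {EA : Enc A} {EB : Enc B} {EC : Enc C}.

Lemma computable_foldl (l : A -> seq B) (z : A -> C) (s : A -> C -> B -> C) :
  computable l -> computable z ->
  computable (fun p : A * (C * B) => s p.1 p.2.1 p.2.2) ->
  computable (fun x => foldl (s x) (z x) (l x)).
Proof.
move=> cl cz cs.
(* Each step consumes one entry. The step is iterated as many times as the code of the list, which
   is at least its length; surplus steps do nothing. *)
pose step x (y : C * seq B) := if y.2 is b :: r then (s x y.1 b, r) else y.
have cstep : computable (fun p : A * (C * seq B) => step p.1 p.2).
  apply: computable_seq_case.
  - exact/computable_snd/computable_snd/computable_id.
  - exact/computable_snd/computable_id.
  apply: computable_pair; last exact/computable_snd/computable_snd/computable_id.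
  apply: (computable_app3 cs).
  - exact/computable_fst/computable_fst/computable_id.
  - exact/computable_fst/computable_snd/computable_fst/computable_id.
  exact/computable_fst/computable_snd/computable_id.
have [l' l'r l'E] := cl.
have cn : computable (fun x => en (l x)) by exists l'.
have := computable_fst (computable_iter cn (computable_pair cz cl) cstep).
apply: computable_ext => x; have : size (l x) <= en (l x).
  by rewrite -(size_map en) size_code.
elim: (l x) (z x) (en (l x)) => [|b r IHr] y [|n] //= ler; last by rewrite -iterS iterSr /= IHr.
by have -> : iter n (step x) (y, [::]) = (y, [::]) by elim: n {ler} => //= n ->.
Qed.

End ComputableFoldl.

Ltac eta_computable :=
  match goal with
  | |- @computable ?A ?B ?EA ?EB ?f => change (@computable A B EA EB (fun x => f x)); cbv beta
  end.

Ltac basic_computability_step := eta_computable;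
  lazymatch goal with
  | |- computable (fun x => x) => exact: computable_id
  | |- computable (fun x => fst (@?f x)) => apply: computable_fst
  | |- computable (fun x => snd (@?f x)) => apply: computable_snd
  | |- computable (fun x => pair (@?f x) (@?g x)) => apply: computable_pair
  | |- computable (fun x => cons (@?f x) (@?g x)) => apply: computable_cons
  | |- computable (fun x => if _ then _ else _) => apply: computable_if
  | |- computable (fun _ => ?c) => exact: computable_cst
  end.
Ltac basic_computability := repeat basic_computability_step.

Section ComputableFoldr.
Context {A B C : Type} {EA : Enc A} {EB : Enc B} {EC : Enc C}.

Lemma computable_rev (l : A -> seq B) : computable l -> computable (fun x => rev (l x)).
Proof.
move=> cl.
have c0 : computable (fun _ : A => [::] : seq B) by basic_computability.
have c1 : computable (fun p : A * (seq B * B) => p.2.2 :: p.2.1) by basic_computability.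
have := computable_foldl (s := fun _ r b => b :: r) cl c0 c1.
apply: computable_ext => x; rewrite -[l x in LHS]revK foldl_rev.
by elim: (rev _) => //= b r ->.
Qed.

Lemma computable_foldr (l : A -> seq B) (z : A -> C) (s : A -> B -> C -> C) :
  computable l -> computable z ->
  computable (fun p : A * (B * C) => s p.1 p.2.1 p.2.2) ->
  computable (fun x => foldr (s x) (z x) (l x)).
Proof.
move=> cl cz cs.
have c1 : computable (fun p : A * (C * B) => s p.1 p.2.2 p.2.1).
  by apply: (computable_app3 cs); basic_computability.
have := computable_foldl (s := fun x r b => s x b r) (computable_rev cl) cz c1.
by apply: computable_ext => x; rewrite foldl_rev.
Qed.

End ComputableFoldr.

Section ComputableMap.
Context {A B C : Type} {EA : Enc A} {EB : Enc B} {EC : Enc C}.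

Lemma computable_map (l : A -> seq B) (f : A -> B -> C) :
  computable l -> computable (fun p : A * B => f p.1 p.2) ->
  computable (fun x => map (f x) (l x)).
Proof.
move=> cl cf.
have c0 : computable (fun _ : A => [::] : seq C) by basic_computability.
have c1 : computable (fun p : A * (B * seq C) => f p.1 p.2.1 :: p.2.2).
  by basic_computability; apply: (computable_app2 cf); basic_computability.
have := computable_foldr (s := fun x b r => f x b :: r) cl c0 c1.
by apply: computable_ext => x; elim: (l x) => //= b r ->.
Qed.

Lemma computable_cat (f g : A -> seq B) :
  computable f -> computable g -> computable (fun x => f x ++ g x).
Proof.
move=> cf cg.
have c1 : computable (fun p : A * (B * seq B) => p.2.1 :: p.2.2) by basic_computability.
have := computable_foldr (s := fun=> cons) cf cg c1.
by apply: computable_ext => x; elim: (f x) => //= b r ->.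
Qed.

Lemma computable_size (f : A -> seq B) : computable f -> computable (fun x => size (f x)).
Proof.
move=> cf.
have c0 : computable (fun _ : A => 0) by basic_computability.
have c1 : computable (fun p : A * (B * nat) => p.2.2.+1).
  have cS : computable succn by exists succn; first exact: recursive1_succ.
  by apply: (computable_app cS); basic_computability.
have := computable_foldr (s := fun _ _ => succn) cf c0 c1.
by apply: computable_ext => x; elim: (f x) => //= b r ->.
Qed.

Lemma computable_has (l : A -> seq B) (P : A -> B -> bool) :
  computable l -> computable (fun p : A * B => P p.1 p.2) ->
  computable (fun x => has (P x) (l x)).
Proof.
move=> cl cP.
have c0 : computable (fun _ : A => false) by basic_computability.
have c1 : computable (fun p : A * (B * bool) => if P p.1 p.2.1 then true else p.2.2).
  by basic_computability; apply: (computable_app2 cP); basic_computability.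
have := computable_foldr (s := fun x b r => if P x b then true else r) cl c0 c1.
by apply: computable_ext => x; elim: (l x) => //= b r ->.
Qed.

Lemma computable_behead (l : A -> seq B) :
  computable l -> computable (fun x => behead (l x)).
Proof.
move=> cl; have c0 : computable (fun _ : A => [::] : seq B) by basic_computability.
have c1 : computable (fun p : A * (B * seq B) => p.2.2) by basic_computability.
have := computable_seq_case (g := fun _ _ r => r) cl c0 c1.
by apply: computable_ext => x; case: (l x).
Qed.

Lemma computable_drop n (l : A -> seq B) :
  computable l -> computable (fun x => drop n (l x)).
Proof.
move=> cl; elim: n => [|n IHn].
  by apply: computable_ext cl => x; rewrite drop0.
by apply: computable_ext (computable_behead IHn) => x; rewrite -drop1 drop_drop.
Qed.

End ComputableMap.

Section ComputableBool.
Context {A B : Type} {EA : Enc A} {EB : Enc B}.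

Lemma computable_take n (l : A -> seq B) :
  computable l -> computable (fun x => take n (l x)).
Proof.
move=> cl; apply: (computable_app (f := take n)) cl.
have c0 : computable (fun _ : seq B => [::] : seq B) by basic_computability.
elim: n => [|n IHn]; first by apply: computable_ext c0 => x; rewrite take0.
have c1 : computable (fun p : seq B * (B * seq B) => p.2.1 :: take n p.2.2).
  by basic_computability; apply: (computable_app IHn); basic_computability.
have := computable_seq_case (g := fun _ b r => b :: take n r) (computable_id (A := seq B)) c0 c1.
by apply: computable_ext; case.
Qed.

Lemma computable_flatten (l : A -> seq (seq B)) :
  computable l -> computable (fun x => flatten (l x)).
Proof.
move=> cl; have c0 : computable (fun _ : A => [::] : seq B) by basic_computability.
have c1 : computable (fun p : A * (seq B * seq B) => p.2.1 ++ p.2.2).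
  by apply: computable_cat; basic_computability.
exact: (computable_foldr (s := fun=> cat) cl c0 c1).
Qed.

Lemma computable_neg (b : A -> bool) : computable b -> computable (fun x => ~~ b x).
Proof.
move=> cb; have : computable (fun x => if b x then false else true) by basic_computability.
by apply: computable_ext => x; case: (b x).
Qed.

Lemma computable_and (b c : A -> bool) :
  computable b -> computable c -> computable (fun x => b x && c x).
Proof.
move=> cb cc; have : computable (fun x => if b x then c x else false) by basic_computability.
by apply: computable_ext => x; case: (b x).
Qed.

Lemma computable_imp (b c : A -> bool) :
  computable b -> computable c -> computable (fun x => b x ==> c x).
Proof.
move=> cb cc; have : computable (fun x => if b x then c x else true) by basic_computability.
by apply: computable_ext => x; case: (b x).
Qed.

End ComputableBool.

Lemma computable_all (A B : Type) {EA : Enc A} {EB : Enc B} (l : A -> seq B) (P : A -> B -> bool) :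
  computable l -> computable (fun p : A * B => P p.1 p.2) ->
  computable (fun x => all (P x) (l x)).
Proof.
move=> cl cP.
have := computable_neg (computable_has (P := fun x b => ~~ P x b) cl (computable_neg cP)).
by apply: computable_ext => x; rewrite has_predC negbK.
Qed.

(** A finite table is computable however its values were obtained. This is how classically chosen
    shortest words enter an algorithm. *)
Lemma computable_finite_support (A : eqType) (B : Type) {EA : Enc A} {EB : Enc B}
    (s : seq A) (f : A -> B) (d : B) :
  injective (en : A -> nat) -> computable (fun x => if x \in s then f x else d).
Proof.
move=> en_inj; elim: s => [|a s IHs]; first by exists (fun=> en d); first exact: recursive1_const.
have ce : computable (fun x : A => en x == en a).
  apply: (computable_rel2 (P := eq_op) recursive_eq (f := en)); last by basic_computability.
  by exists id => [|x]; first exact: recursive1_id.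
have ct : computable (fun x => if en x == en a then f a else if x \in s then f x else d).
  by apply: computable_if => //; basic_computability.
apply: computable_ext ct => x; rewrite (inj_eq en_inj) inE.
by case: eqP => //= ->.
Qed.

Lemma en_seq_inj A {EA : Enc A} : injective (en : A -> nat) -> injective (en : seq A -> nat).
Proof. by move=> en_inj s t /(can_inj CodeSeq.codeK) /(inj_map en_inj). Qed.

Instance enc_letter (X : finType) : Enc (letter X) := @letter_code X.
Instance enc_word (X : finType) : Enc (word X) := @enc_seq (letter X) _.

Lemma letter_code_inj (X : finType) : injective (@letter_code X).
Proof.
move=> [x b] [y c] /= eq_xy; rewrite /letter_code /= in eq_xy.
have eq_bc : b = c.
  by have := congr1 odd eq_xy; rewrite !oddD !odd_double /=; case: b c {eq_xy} => [] [].
by move: eq_xy; rewrite eq_bc => /addIn /double_inj /val_inj /enum_rank_inj ->.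
Qed.

Lemma word_en_inj (X : finType) : injective (en : word X -> nat).
Proof. exact: en_seq_inj (@letter_code_inj X). Qed.

(** The first [t] that satisfies [P] is handed to [Q]; halting is claimed only on inputs for which
    the search succeeds. *)
Lemma recursive_search (T : Type) {ET : Enc T} (P Q : T -> nat -> bool) :
  computable (fun p : T * nat => P p.1 p.2) ->
  computable (fun p : T * nat => Q p.1 p.2) ->
  exists f : recfun 1, forall x, (exists t, P x t) ->
    exists2 t, P x t & rec_eval f [tuple en x] (Q x t).
Proof.
move=> [P' P'r P'E] [Q' Q'r Q'E].
have PE (x : T) k : P' (natpair (en x) k) = P x k by exact: (P'E (x, k)).
have QE (x : T) k : Q' (natpair (en x) k) = Q x k by exact: (Q'E (x, k)).
have [fp fpE] : recursive2 (fun t x => 1 - P' (natpair x t)).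
  apply: (recursive22_comp recursive_sub (recursive2_const 1)).
  apply: (recursive12_comp P'r); exact: recursive_swap recursive_natpair.
have [fq fqE] := recursive12_comp Q'r recursive_natpair.
exists (RComp fq (tnth [tuple @projn 1 0 isT; RMin fp])) => x exP.
have [t Pt tmin] := ex_minnP exP; exists t => //.
rewrite -QE; apply: rec_comp2 (fqE _ _); first exact: rec_proj.
split=> [|k lt_kt].
  by have := fpE t (@en T ET x); rewrite PE Pt.
exists 0; have := fpE k (@en T ET x); rewrite PE.
by case: (boolP (P x k)) => // /tmin; rewrite leqNgt lt_kt.
Qed.

Ltac seq_computability_step := eta_computable;
  lazymatch goal with
  | |- computable (fun x => cat _ _) => apply: computable_cat
  | |- computable (fun x => rev _) => apply: computable_rev
  | |- computable (fun x => take _ _) => apply: computable_take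
  | |- computable (fun x => drop _ _) => apply: computable_drop
  | |- computable (fun x => size _) => apply: computable_size
  | |- computable (fun x => flatten _) => apply: computable_flatten
  | |- computable (fun x => map _ _) => apply: computable_map
  | |- computable (fun x => has _ _) => apply: computable_has
  | |- computable (fun x => all _ _) => apply: computable_all
  | |- computable (fun x => andb _ _) => apply: computable_and
  | |- computable (fun x => negb _) => apply: computable_neg
  | |- computable (fun x => implb _ _) => apply: computable_imp
  | |- computable (fun x => addn _ _) => apply: (computable_nat2 recursive_add)
  | |- computable (fun x => muln _ _) => apply: (computable_nat2 recursive_mul)
  | |- computable (fun x => leq _ _) => apply: (computable_rel2 recursive_leq)
  | |- _ => basic_computability_step
  end.
Ltac seq_computability := repeat seq_computability_step.

Section Words.
Context {X : finType}.

Fixpoint words r : seq (word X) :=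
  if r is r'.+1 then [::] :: flatten [seq [seq a :: w | w <- words r'] | a <- enum {: X * bool}]
  else [:: [::]].

Lemma mem_words r (w : word X) : (w \in words r) = (size w <= r).
Proof.
elim: r w => [|r IHr] [|a w] //=; rewrite inE /=.
apply/flatten_mapP/idP => [[b _ /mapP[v]] | le_wr].
  by rewrite IHr => le_vr [_ ->].
by exists a; [rewrite mem_enum | apply/mapP; exists w; rewrite ?IHr].
Qed.

Lemma computable_words : computable words.
Proof.
pose step (P : seq (word X)) : seq (word X) :=
  [::] :: flatten [seq [seq a :: w | w <- P] | a <- enum {: X * bool}].
have cstep : computable (fun p : nat * seq (word X) => step p.2).
  by rewrite /step; seq_computability.
have c1 : computable (fun _ : nat => [:: [::] : word X]) by seq_computability.
have := computable_iter (s := fun=> step) (computable_id (A := nat)) c1 cstep.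
by apply: computable_ext; elim=> //= r ->.
Qed.

End Words.

Import Order.TTheory GRing.Theory Num.Theory.
Local Open Scope group_scope.

(** * The word metric *)

Section WordMetric.
Context {X : finType} {G : groupType} (gen : X -> G).

Notation wval := (word_val gen).

Lemma word_val_cat u v : wval (u ++ v) = wval u * wval v.
Proof. exact: big_cat. Qed.

Lemma word_val_nil : wval [::] = 1.
Proof. exact: big_nil. Qed.

Lemma word_val_cons a v : wval (a :: v) = letter_val gen a * wval v.
Proof. exact: big_cons. Qed.

Definition word_inv (w : word X) : word X := rev (map (@letter_inv X) w).

Lemma size_word_inv w : size (word_inv w) = size w.
Proof. by rewrite size_rev size_map. Qed.

Lemma word_val_inv w : wval (word_inv w) = (wval w)^-1.
Proof.
rewrite /word_inv; elim: w => [|a w IHw]; first by rewrite word_val_nil invg1.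
rewrite /= rev_cons -cats1 word_val_cat IHw [wval (a :: w)]word_val_cons invgM; congr (_ * _).
rewrite word_val_cons word_val_nil mulg1 /letter_val /letter_inv /=.
by case: a.2; rewrite /= ?invgK.
Qed.

Lemma path_endE g w : path_end gen g w = g * wval w.
Proof.
rewrite /path_end /path_vertices; elim: w g => [|a w IHw] g /=.
  by rewrite word_val_nil mulg1.
by have /= -> := IHw; rewrite word_val_cons mulgA.
Qed.

Lemma mem_path_vertices g w v :
  reflect (exists u1 u2, w = u1 ++ u2 /\ v = g * wval u1) (v \in path_vertices gen g w).
Proof.
apply: (iffP idP); rewrite /path_vertices.
  elim: w g => [|a w IHw] g /=.
    by rewrite inE => /eqP ->; exists [::], [::]; rewrite word_val_nil mulg1.
  rewrite inE => /orP[/eqP -> | /IHw[u1 [u2 [-> ->]]]].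
    by exists [::], (a :: w); rewrite word_val_nil mulg1.
  by exists (a :: u1), u2; rewrite word_val_cons mulgA.
case=> u1 [u2 [-> ->]]; elim: u1 g => [|a u1 IHu] g /=.
  by rewrite word_val_nil mulg1 mem_head.
by rewrite inE word_val_cons mulgA IHu orbT.
Qed.

Hypothesis gen_surj : forall g, exists w, wval w = g.

Lemma norm_subproof g : exists n, `[< exists2 w, wval w = g & size w = n >].
Proof. by have [w wg] := gen_surj g; exists (size w); apply/asboolP; exists w. Qed.

Definition norm g := ex_minn (norm_subproof g).

Lemma norm_word g : exists2 w, wval w = g & size w = norm g.
Proof. by rewrite /norm; case: ex_minnP => n /asboolP. Qed.

Lemma norm_val w : norm (wval w) <= size w.
Proof.
by rewrite /norm; case: ex_minnP => n _; apply; apply/asboolP; exists w.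
Qed.

Lemma norm1 : norm 1 = 0.
Proof. by have := norm_val [::]; rewrite word_val_nil leqn0 => /eqP. Qed.

Lemma norm_eq0 g : norm g = 0 -> g = 1.
Proof. by have [w <- <-] := norm_word g => /size0nil ->; rewrite word_val_nil. Qed.

Lemma normM x y : norm (x * y) <= norm x + norm y.
Proof.
have [u <- <-] := norm_word x; have [v <- <-] := norm_word y.
by rewrite -word_val_cat -size_cat norm_val.
Qed.

Lemma normV x : norm x^-1 = norm x.
Proof.
have le_normV y : norm y^-1 <= norm y.
  by have [w <- <-] := norm_word y; rewrite -word_val_inv -size_word_inv norm_val.
by apply/eqP; rewrite eqn_leq le_normV -{1}[x]invgK le_normV.
Qed.

Definition dist x y := norm (x^-1 * y).

Lemma dist_sym x y : dist x y = dist y x.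
Proof. by rewrite /dist -normV invgM invgK. Qed.

Lemma dist_tri y x z : dist x z <= dist x y + dist y z.
Proof. by rewrite /dist -[x^-1 * z](divgKA y^-1) invgK normM. Qed.

Lemma dist_mul g x y : dist (g * x) (g * y) = dist x y.
Proof. by rewrite /dist invgM -mulgA mulKg. Qed.

Lemma distxx x : dist x x = 0.
Proof. by rewrite /dist mulVg norm1. Qed.

Lemma dist_eq0 x y : dist x y = 0 -> x = y.
Proof. by move=> /norm_eq0 /mulg1_eq; rewrite invgK. Qed.

Lemma dist1 x : dist 1 x = norm x.
Proof. by rewrite /dist invg1 mul1g. Qed.

(** Says that [v] lies on some geodesic from [x] to [y]; paths are thereby replaced by an equation
    between integers. *)
Definition btw x v y := dist x v + dist v y = dist x y.

Lemma btw_sym x v y : btw x v y -> btw y v x.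
Proof. by rewrite /btw ![dist y _]dist_sym [dist v x]dist_sym addnC. Qed.

Lemma btw_mul g x v y : btw (g * x) (g * v) (g * y) <-> btw x v y.
Proof. by rewrite /btw !dist_mul. Qed.

Lemma geodesicP g w : geodesic gen g w <-> size w = norm (wval w).
Proof.
split=> [geo_w | size_w w']; last first.
  by rewrite !path_endE => /mulgI eqw; rewrite size_w -eqw norm_val.
have [w' w'E size_w'] := norm_word (wval w).
by apply/eqP; rewrite eqn_leq norm_val andbT -size_w' geo_w // !path_endE w'E.
Qed.

Lemma geodesic_cat u v : size (u ++ v) = norm (wval (u ++ v)) ->
  size u = norm (wval u) /\ size v = norm (wval v).
Proof.
rewrite size_cat word_val_cat.
have := normM (wval u) (wval v); have := norm_val u; have := norm_val v; lia.
Qed.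

Lemma geodesic_path x y : exists v : nat -> G,
  [/\ v 0 = x, v (dist x y) = y
    & forall i j, i <= j -> j <= dist x y -> dist (v i) (v j) = j - i].
Proof.
have [w wE size_w] := norm_word (x^-1 * y); rewrite -/(dist x y) in size_w.
exists (fun i => x * wval (take i w)); split.
- by rewrite take0 word_val_nil mulg1.
- by rewrite -size_w take_size wE mulVKg.
move=> i j le_ij; rewrite -size_w => le_jn; rewrite dist_mul /dist.
have -> : take j w = take i w ++ drop i (take j w).
  by rewrite -{1}(cat_take_drop i (take j w)) take_takel.
rewrite word_val_cat mulKg.
have : size w = norm (wval w) by rewrite size_w wE.
rewrite -{1 2}(cat_take_drop j w) => /geodesic_cat[+ _].
rewrite -{1 2}(cat_take_drop i (take j w)) => /geodesic_cat[_ <-].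
by rewrite size_drop size_takel.
Qed.

Lemma geodesic_point x y i : i <= dist x y ->
  exists2 v, dist x v = i & dist v y = dist x y - i.
Proof.
have [v [v0 vn vP]] := geodesic_path x y => le_in.
exists (v i); first by have := vP 0 i; rewrite v0 subn0; apply.
by have := vP i (dist x y); rewrite vn; apply.
Qed.

Section Hyperbolic.
Variables (R : realType) (delta : R) (d : nat).
Hypothesis curv : negatively_curved gen delta.
Hypothesis le_delta : (delta <= d%:R)%R.

(** Shortest words for the two halves of the side through [v] concatenate to a geodesic, to which
    the curvature hypothesis on paths applies. *)
Lemma slim x y z v : btw x v y ->
  exists2 u, btw x u z \/ btw z u y & dist u v <= d.
Proof.
have [a aE size_a] := norm_word (x^-1 * v); have [b bE size_b] := norm_word (v^-1 * y).
have [w2 w2E size_w2] := norm_word (y^-1 * z); have [w3 w3E size_w3] := norm_word (z^-1 * x).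
move=> bxy; have abE : wval (a ++ b) = x^-1 * y by rewrite word_val_cat aE bE -mulgA mulVKg.
have geo1 : geodesic gen x (a ++ b).
  by apply/geodesicP; rewrite abE size_cat size_a size_b.
have geo2 : geodesic gen y w2 by apply/geodesicP; rewrite w2E.
have geo3 : geodesic gen z w3 by apply/geodesicP; rewrite w3E.
have [|||p1 _ _] := curv geo1 geo2 geo3; rewrite ?path_endE ?abE ?w2E ?w3E ?mulVKg //.
have side p q w u1 u2 : wval w = p^-1 * q -> size w = dist p q -> w = u1 ++ u2 ->
    btw p (p * wval u1) q.
  move=> wE size_w w_cat; have sizeE : size (u1 ++ u2) = norm (wval (u1 ++ u2)).
    by rewrite -w_cat size_w wE.
  have [s1 s2] := geodesic_cat sizeE.
  rewrite /btw -size_w w_cat size_cat s1 s2; congr (_ + _); rewrite /dist ?mulKg //.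
  by rewrite invgM -mulgA -wE w_cat word_val_cat mulKg.
have /p1[w [uP le_w]] : [set` path_vertices gen x (a ++ b)]%classic v.
  by apply/mem_path_vertices; exists a, b; rewrite aE mulVKg.
rewrite path_endE in uP; exists (v * wval w); last first.
  rewrite dist_sym /dist mulKg (leq_trans (norm_val w)) // -(ler_nat R).
  exact: le_trans le_w le_delta.
case: uP => /mem_path_vertices[u1 [u2 [wE ->]]]; [right | left]; apply: btw_sym.
  exact: side w2E size_w2 wE.
exact: side w3E size_w3 wE.
Qed.

End Hyperbolic.
End WordMetric.

(** * Slim triangles *)

Section SlimGroup.
Context {X : finType} {G : groupType} (gen : X -> G).
Hypothesis gen_surj : forall g, exists w, word_val gen w = g.
Notation norm := (norm gen_surj).
Notation dist := (dist gen_surj).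
Notation btw := (btw gen_surj).

Variable d : nat.
Hypothesis slimd : forall x y z v, btw x v y ->
  exists2 u, btw x u z \/ btw z u y & dist u v <= d.

(** One of the sides [x w] and [y w] passes within [d] of [v]; a detour of that side through [v]
    lengthens it by at most 2d. *)
Lemma btw_convex x v y w : btw x v y ->
  dist v w + dist x v <= dist x w + d.*2 \/ dist v w + dist v y <= dist y w + d.*2.
Proof.
move=> /(slimd w)[u [] bu le_uv]; rewrite /btw in bu; [left | right].
  by have := dist_tri gen_surj u v w; have := dist_tri gen_surj u x v;
    rewrite (dist_sym _ v u); lia.
have := dist_tri gen_surj u v w; have := dist_tri gen_surj u v y.
by rewrite (dist_sym _ v u) (dist_sym _ y w) (dist_sym _ u w); lia.
Qed.

(** The diagonal from [x] to [y'] cuts the quadrilateral into two slim triangles. *)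
Lemma slim_quad x y x' y' v : btw x v y ->
  exists2 u, [\/ btw x u x', btw x' u y' | btw y' u y] & dist u v <= d.*2.
Proof.
move=> /(slimd y')[u [bu|bu] le_uv]; last by exists u; [constructor 3 | lia].
have [t tP le_tu] := slimd x' bu; exists t.
  by case: tP => ?; [constructor 1 | constructor 2].
by have := dist_tri gen_surj u t v; lia.
Qed.

Lemma btw_l x y : btw x x y.
Proof. by rewrite /btw distxx. Qed.

Lemma btwxx x u : btw x u x -> u = x.
Proof. by rewrite /btw distxx => xux; apply: (dist_eq0 (gen_surj := gen_surj)); lia. Qed.

(** A point of the side [x x'] within 2d of [v] would force [dist x v <= dist x x' + 2d]. When
    [x = x'] that side is a single point, which lies on [x' y'] anyway. The other end is similar. *)
Lemma slim_quad_far x y x' y' v : btw x v y ->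
  x = x' \/ dist x x' + d.*2 < dist x v ->
  y = y' \/ dist y y' + d.*2 < dist v y ->
  exists2 u, btw x' u y' & dist u v <= d.*2.
Proof.
move=> bv xx' yy'; have [u uP le_uv] := slim_quad x' y' bv; exists u => //.
case: uP => // bu.
  case: xx' => [xx'|]; first by move: bu; rewrite xx' => /btwxx ->; exact: btw_l.
  by move: bu; rewrite /btw; have := dist_tri gen_surj u x v; lia.
case: yy' => [yy'|].
  by move: bu; rewrite yy' => /btwxx ->; apply: btw_sym; exact: btw_l.
move: bu; rewrite /btw; have := dist_tri gen_surj u v y.
by rewrite (dist_sym _ v u) (dist_sym _ y y'); lia.
Qed.

(** If the nearby point falls on a short side, the corner [x'] or [y'] replaces it at the cost of at
    most [c]. *)
Lemma slim_quad_near c x y x' y' v : btw x v y ->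
  dist x x' <= c -> dist y y' <= c -> exists2 u, btw x' u y' & dist u v <= d.*2 + c.
Proof.
move=> bv xx' yy'; have [u uP le_uv] := slim_quad x' y' bv.
case: uP => bu; [exists x' | exists u | exists y'] => //; try (by lia).
- exact: btw_l.
- move: bu; rewrite /btw; have := dist_tri gen_surj u x' v.
  by rewrite (dist_sym _ x' u); lia.
- by apply: btw_sym; exact: btw_l.
- move: bu; rewrite /btw; have := dist_tri gen_surj u y' v.
  by have := dist_sym gen_surj y y'; lia.
Qed.

(* A point of the closed path farthest from the base point lies between two
   points of the path that are 2d+1 steps away, against btw_convex. *)
Lemma closed_local_geodesic (p : nat -> G) n :
  p 0 = 1 -> p n = 1 ->
  (forall i j, i <= j -> j <= n -> j - i <= (d.*2.+1).*2 -> dist (p i) (p j) = j - i) ->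
  n = 0.
Proof.
move=> p0 pn p_geo; case: (leqP n (d.*2.+1).*2) => [le_n | lt_n].
  by have := p_geo 0 n isT (leqnn _); rewrite subn0 p0 pn distxx => ->.
have lip i j : i <= j -> j <= n -> dist (p i) (p j) <= j - i.
  move=> le_ij; elim: j le_ij => [|j IHj].
    by rewrite leqn0 => /eqP -> _; rewrite distxx.
  rewrite leq_eqVlt => /orP[/eqP -> _|]; first by rewrite distxx.
  rewrite ltnS => le_ij lt_jn; have := IHj le_ij (ltnW lt_jn).
  have := p_geo j j.+1 (leqnSn _) lt_jn; rewrite subSnn => /(_ isT).
  by have := dist_tri gen_surj (p j) (p i) (p j.+1); lia.
have [j le_jn jmax] : exists2 j, j <= n & forall i, i <= n -> norm (p i) <= norm (p j).
  case: (@arg_maxnP 'I_n.+1 ord0 xpredT (fun i => norm (p i)) isT) => j _ jmax.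
  exists j => [|i le_in]; first by rewrite -ltnS.
  exact: (jmax (Ordinal (le_in : i < n.+1))).
(* After its first window the path is at distance 4d + 2 from the base point. Hence the farthest
   point [p j] is at least that many steps from both ends, and the indices [i] and [k] below are in
   range. *)
have := p_geo 0 _ isT (ltnW lt_n) (leqnn _); rewrite p0 dist1 subn0 => dN.
have := jmax _ (ltnW lt_n); rewrite dN => lt_j.
have := lip 0 j isT le_jn; rewrite p0 dist1 => le_j.
have := lip j n le_jn (leqnn _); rewrite pn dist_sym dist1 => le_nj.
pose i := j - d.*2.+1; pose k := j + d.*2.+1.
have dij : dist (p i) (p j) = d.*2.+1 by rewrite p_geo /i; lia.
have djk : dist (p j) (p k) = d.*2.+1 by rewrite p_geo /k; lia.
have dik : dist (p i) (p k) = (d.*2.+1).*2 by rewrite p_geo /i /k; lia.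
have bj : btw (p i) (p j) (p k) by rewrite /btw; lia.
have le_ij := jmax i; have le_kj := jmax k.
have := btw_convex 1 bj.
rewrite dij djk [dist (p j) 1]dist_sym [dist (p i) 1]dist_sym [dist (p k) 1]dist_sym !dist1.
by rewrite /i /k in le_ij le_kj *; lia.
Qed.

(** * Propagation of a local subgroup along geodesics *)

Section LocalSubgroup.
(** [S] is closed under products inside the ball of radius [r] only. [m1] is the width of a chain,
    [m2] its width after multiplication by an element of length at most [c], and [w] the half-length
    of the window in which the width is restored. *)
Variables (S : G -> Prop) (m m1 m2 w c r : nat).
Hypotheses (m1E : m1 = m + d.*2) (m2E : m2 = m1 + c.*2 + d.*2) (wE : w = m2 + d.*2.+1).
Hypothesis le_r : w.*2 + m2.*2 <= r.
Hypotheses (S1 : S 1) (SV : forall x, S x -> S x^-1)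
  (SM : forall x y, S x -> S y -> norm (x * y) <= r -> S (x * y))
  (S_qc : forall x v, S x -> norm x <= w.*2 + m2.*2 -> btw 1 v x ->
     exists2 u, S u & dist u v <= m).

(* h is joined to 1 by a chain of S-steps that follows a geodesic at distance M. *)
Definition chain M h := exists v u : nat -> G,
  [/\ v 0 = 1, v (norm h) = h
    & forall i j, i <= j -> j <= norm h -> dist (v i) (v j) = j - i] /\
  [/\ u 0 = 1, u (norm h) = h, (forall i, i <= norm h -> dist (u i) (v i) <= M)
    & forall i, i < norm h -> S ((u i)^-1 * u i.+1)].

(** The steps telescope, and each partial product has length at most [j - i + 2M], hence stays in
    the ball where [S] is closed. *)
Lemma chain_segment M n (u v : nat -> G) :
  (forall i j, i <= j -> j <= n -> dist (v i) (v j) = j - i) ->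
  (forall i, i <= n -> dist (u i) (v i) <= M) ->
  (forall i, i < n -> S ((u i)^-1 * u i.+1)) ->
  forall i j, i <= j -> j <= n -> j - i + M.*2 <= r -> S ((u i)^-1 * u j).
Proof.
move=> vP uM uS i j le_ij; elim: j le_ij => [|j IHj].
  by rewrite leqn0 => /eqP -> _ _; rewrite mulVg.
rewrite leq_eqVlt => /orP[/eqP -> _|]; first by rewrite mulVg.
rewrite ltnS => le_ij lt_jn le_jr; rewrite -(divgKA (u j)^-1) invgK.
apply: SM; [apply: IHj; lia | exact: uS | rewrite mulgA mulgK -/(dist _ _)].
have := uM i; have := uM j.+1; have := vP i j.+1.
have := dist_tri gen_surj (v i) (u i) (u j.+1).
by have := dist_tri gen_surj (v j.+1) (v i) (u j.+1); rewrite (dist_sym _ (v j.+1)); lia.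
Qed.

Lemma chain_mem h : chain m1 h -> norm h + m1.*2 <= r -> S h.
Proof.
case=> v [u [[_ _ vP] [u0 un uM uS]]] le_hr.
have := chain_segment vP uM uS (leq0n _) (leqnn _).
by rewrite u0 un invg1 mul1g subn0; apply.
Qed.

Lemma chain1 : chain m1 1.
Proof.
exists (fun=> 1), (fun=> 1); rewrite norm1; split; split=> // i.
- by move=> j le_ij; rewrite leqn0 => /eqP ->; rewrite distxx.
- by rewrite distxx.
Qed.

(* Following a geodesic for h a instead of h costs 2c + 2d, since the two geodesics
   start together and end at distance at most c. *)
Lemma chain_coarse h a : chain m1 h -> S a -> norm a <= c -> chain m2 (h * a).
Proof.
case=> v [u [[v0 vn vP] [u0 un uM uS]]] Sa le_ac.
have [v' []] := geodesic_path gen_surj 1 (h * a).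
rewrite dist1; set n' := norm (h * a); set n := norm h in vn vP un uM uS * => v'0 v'n v'P.
have dha : dist h (h * a) <= c by rewrite /dist mulKg.
have le_nn' : n' <= n + c by have := normM gen_surj h a; rewrite -/n -/n'; lia.
have le_n'n : n <= n' + c.
  have := dist_tri gen_surj (h * a) 1 h.
  by rewrite !dist1 -/n -/n' (dist_sym _ (h * a)); lia.
(* The new chain follows [u], waits at [h] if the new geodesic is longer, and jumps to [h * a] in
   its last step. *)
exists v', (fun i => if i < n' then u (minn i n) else h * a); split; split=> //.
- case: ltnP => [_|]; first by rewrite min0n.
  by rewrite leqn0 => /eqP /norm_eq0 ->.
- by rewrite ltnn.
- move=> i; rewrite leq_eqVlt => /orP[/eqP ->|lt_in].
    by rewrite ltnn v'n distxx.
  rewrite lt_in; have := uM (minn i n); rewrite geq_minr => /(_ isT).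
  have dv : dist (v (minn i n)) (v' i) <= c.*2 + d.*2.
    have := v'P 0 i isT (ltnW lt_in); rewrite v'0 dist1.
    have := v'P i n' (ltnW lt_in) (leqnn _); rewrite v'n => d1 d2.
    have dhi := dist_tri gen_surj (h * a) h (v' i).
    rewrite (dist_sym _ (h * a) (v' i)) in dhi.
    case: (leqP i n) => [le_in|lt_ni]; last by rewrite vn; lia.
    have dvi0 := vP 0 i isT le_in; have dvin := vP i n le_in (leqnn _).
    rewrite v0 dist1 in dvi0; rewrite vn in dvin.
    have bi : btw 1 (v i) h by rewrite /btw !dist1 -/n; lia.
    by have := btw_convex (v' i) bi; rewrite !dist1; lia.
  by have := dist_tri gen_surj (v (minn i n)) (u (minn i n)) (v' i); lia.
move=> i lt_in; rewrite lt_in; case: ltnP => [lt_i1 | le_i1].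
  case: (ltnP i n) => [lt_in2|le_ni].
    by rewrite (minn_idPl lt_in2); exact: uS.
  by rewrite (minn_idPr _) ?mulVg // ltnW.
(* Here [n' = i + 1] and [n <= n' + c], so the part of the old chain that is skipped is a short
   segment. *)
have Suh : S ((u (minn i n))^-1 * h).
  by rewrite -un; apply: (chain_segment vP uM uS) => //; rewrite ?geq_minr //; lia.
rewrite mulgA; apply: SM => //.
apply: leq_trans (normM _ _ _) _; rewrite -/(dist _ h).
have := uM (minn i n); rewrite geq_minr => /(_ isT).
have := vP (minn i n) n (geq_minr _ _) (leqnn _); rewrite vn.
have := dist_tri gen_surj (v (minn i n)) (u (minn i n)) h.
by lia.
Qed.

(* The vertex v_j is 2d-close to a geodesic joining u_{j-w} and u_{j+w}, whose ends
   differ by an element of S; so it is (m + 2d)-close to u_{j-w} S, whatever m2 is. *)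
Lemma chain_refine h : chain m2 h -> chain m1 h.
Proof.
case=> v [u [[v0 vn vP] [u0 un uM uS]]]; set n := norm h in vn vP un uM uS *.
pose a j := u (j - w).
have useg := chain_segment vP uM uS.
have vsym i j : i <= n -> j <= n -> dist (v i) (v j) = (i - j) + (j - i).
  move=> le_in le_jn; case: (leqP i j) => [le_ij|/ltnW le_ji].
    by rewrite vP //; lia.
  by rewrite dist_sym vP //; lia.
have /choice[u' u'P] : forall j, exists x, j <= n ->
    [/\ dist x (v j) <= m1, S ((a j)^-1 * x), j = 0 -> x = 1 & j = n -> x = h].
  move=> j.
  case: (leqP j n) => [le_jn|]; last by exists 1.
  case: (posnP j) => [->|j_gt0].
    exists 1 => _; rewrite v0 distxx /a sub0n u0 invg1 mulg1; split=> // n0.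
    by rewrite (norm_eq0 (esym n0)).
  case: (ltngtP j n) le_jn => // [lt_jn _|jn _]; last first.
    exists h => _; split=> //; first by rewrite jn vn distxx.
      by rewrite /a -un; apply: useg; lia.
    by move=> j0; exfalso; lia.
  pose b := u (minn (j + w) n).
  have Sab : S ((a j)^-1 * b) by apply: useg; lia.
  pose i := j - w; pose k := minn (j + w) n.
  have iE : i = j - w by []. have kE : k = minn (j + w) n by [].
  have le_in : i <= n by lia.
  have le_kn : k <= n by lia.
  have bj : btw (v i) (v j) (v k) by rewrite /btw !vsym //; lia.
  have dai : dist (v i) (a j) <= m2 by rewrite dist_sym; exact: uM.
  have dbk : dist (v k) b <= m2 by rewrite dist_sym; exact: uM.
  (* Each end of the window is either [w = m2 + 2d + 1] steps from [v j], beyond the reach of the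
     short side, or truncated at an end of the geodesic, where the chain meets it. *)
  have [||x bx le_xv] := slim_quad_far bj (x' := a j) (y' := b).
  - case: (leqP j w) => [le_jw|lt_wj]; last by right; rewrite vsym //; lia.
    by left; rewrite /a /i (eqP (le_jw : j - w == 0)) v0 u0.
  - case: (leqP (j + w) n) => [le_jw|lt_wj]; first by right; rewrite vsym //; lia.
    by left; rewrite /b /k (minn_idPr (ltnW lt_wj)) vn un.
  have : btw ((a j)^-1 * a j) ((a j)^-1 * x) ((a j)^-1 * b) by apply/btw_mul.
  rewrite mulVg => /(S_qc Sab) [|s Ss le_sx].
    rewrite -/(dist _ _); have := dist_tri gen_surj (v i) (a j) b.
    have := dist_tri gen_surj (v k) (v i) b; rewrite (dist_sym _ (v i) (a j)) in dai *.
    have -> : dist (v i) (v k) = k - i by apply: vP; lia.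
    by lia.
  exists (a j * s) => _; split; first 1 last.
  - by rewrite mulKg.
  - by move=> j0; rewrite j0 in j_gt0.
  - by move=> jn; rewrite jn ltnn in lt_jn.
  have := dist_tri gen_surj x (a j * s) (v j).
  by rewrite -(dist_mul _ (a j)^-1 (a j * s) x) mulKg; lia.
exists v, u'; split; split=> //.
- by have [_ _ ->] := u'P 0 (leq0n _).
- by have [_ _ _ ->] := u'P n (leqnn _).
- by move=> i /u'P[].
move=> j lt_jn; have [dj Sj _ _] := u'P j (ltnW lt_jn); have [dj1 Sj1 _ _] := u'P j.+1 lt_jn.
have Saa : S ((a j)^-1 * a j.+1) by apply: useg; lia.
(* The new step is routed through [a j] and [a j.+1], so that both successive products stay in the
   ball of radius [r]. *)
have -> : (u' j)^-1 * u' j.+1 =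
    ((a j)^-1 * u' j)^-1 * ((a j)^-1 * a j.+1) * ((a j.+1)^-1 * u' j.+1).
  by rewrite invgM invgK !mulgA !mulgK.
have E1 : ((a j)^-1 * u' j)^-1 * ((a j)^-1 * a j.+1) = (u' j)^-1 * a j.+1.
  by rewrite invgM invgK !mulgA mulgK.
have djS : dist (v j) (v j.+1) = 1%N by rewrite vP // subSnn.
apply: SM => //; first apply: SM => //; first exact: SV.
  rewrite E1 -/(dist _ _).
  have := uM (j.+1 - w); rewrite -/(a j.+1) => /(_ ltac:(lia)).
  have := vsym j (j.+1 - w) (ltnW lt_jn) ltac:(lia).
  have := dist_tri gen_surj (v j) (u' j) (a j.+1).
  have := dist_tri gen_surj (v (j.+1 - w)) (v j) (a j.+1).
  by rewrite (dist_sym _ (a j.+1)); lia.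
rewrite E1 mulgA mulgK -/(dist _ _).
have := dist_tri gen_surj (v j) (u' j) (u' j.+1).
have := dist_tri gen_surj (v j.+1) (v j) (u' j.+1).
by rewrite (dist_sym _ (v j.+1)); lia.
Qed.

Lemma chain_mul h a : chain m1 h -> S a -> norm a <= c -> chain m1 (h * a).
Proof. by move=> ch Sa le_ac; apply: chain_refine; exact: chain_coarse. Qed.

End LocalSubgroup.
End SlimGroup.

(** * Bounds on conjugators *)

Section Conjugates.
Context {X : finType} {G : groupType} (gen : X -> G).
Hypothesis gen_surj : forall g, exists w, word_val gen w = g.
Notation norm := (norm gen_surj).
Notation dist := (dist gen_surj).
Notation btw := (btw gen_surj).

Variable d : nat.
Hypothesis slimd : forall x y z v, btw x v y ->
  exists2 u, btw x u z \/ btw z u y & dist u v <= d.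

Definition metric_quasiconvex m (H : set G) := forall x y v,
  H x -> H y -> btw x v y -> exists2 u, H u & dist u v <= m.

Lemma ball_word r g : norm g <= r -> exists2 w, w \in words r & word_val gen w = g.
Proof.
by have [w wE size_w] := norm_word gen_surj g; exists w; rewrite ?mem_words ?size_w.
Qed.

Lemma pigeonhole (T : eqType) (s : seq T) n (f : nat -> T) :
  (forall i, i < n -> f i \in s) -> size s < n ->
  exists i j, [/\ i < j, j < n & f i = f j].
Proof.
move=> fs lt_sn.
suff [i [j [lt_in lt_jn neq_ij eq_f]]] :
    exists i j, [/\ i < n, j < n, i != j & f i = f j].
  by case: (ltngtP i j) neq_ij => // lt_ij _; [exists i, j | exists j, i].
apply: contrapT => noncoll.
have : uniq (map f (iota 0 n)).
  rewrite map_inj_in_uniq ?iota_uniq // => i j; rewrite !mem_iota !add0n /= => lt_in lt_jn eq_f.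
  by apply: contrapT => /eqP neq_ij; apply: noncoll; exists i, j.
move=> /uniq_leq_size => /(_ s); rewrite size_map size_iota leqNgt lt_sn.
suff fsub : {subset [seq f i | i <- iota 0 n] <= s} by move/(_ fsub).
by move=> x /mapP[i]; rewrite mem_iota => /fs fi ->.
Qed.

(** Balls are finite, so bounded powers would repeat and [h] would have finite order. *)
Lemma unbounded_powers h r : torsion_free G -> h <> 1 -> exists i, r < norm (h ^+ i).
Proof.
move=> tfG h1; apply: contrapT => bounded.
have /choice[f fP] : forall i, exists w, w \in words r /\ word_val gen w = h ^+ i.
  move=> i; have [|w] := @ball_word r (h ^+ i); last by exists w.
  by rewrite leqNgt; apply/negP => lt_r; apply: bounded; exists i.
have [|i [j [lt_ij _ eq_f]]] := @pigeonhole _ (words r) _ f _ (ltnSn _).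
  by move=> i _; have [] := fP i.
apply: h1; apply: (tfG h (j - i)); first by rewrite subn_gt0.
by rewrite expgnFr ?(ltnW lt_ij) // -(fP i).2 -(fP j).2 eq_f mulgV.
Qed.

Section Bounds.
Variables (H K : set G) (m : nat).
Hypotheses (sgH : is_subgroup H) (sgK : is_subgroup K).
Hypotheses (qcH : metric_quasiconvex m H) (qcK : metric_quasiconvex m K).

Lemma subgroupX (L : set G) x n : is_subgroup L -> L x -> L (x ^+ n).
Proof.
by case=> L1 LM _ Lx; elim: n => [|n IHn]; [rewrite expg0 | rewrite expgS; apply: LM].
Qed.

(* Since the powers of h are unbounded, the quasi-lines g h^i and k^i, where
   k = g h g^-1, come close to each other; so do K and g H. *)
Lemma short_conjugator h g : torsion_free G -> H h -> h <> 1 -> K (g * h * g^-1) ->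
  exists g' h', [/\ norm g' <= m.*2 + d.*2, H h', h' <> 1 & K (g' * h' * g'^-1)].
Proof.
(* With this [q], a point of the geodesic from 1 to [k] at least [q] away from both ends escapes the
   short sides, of length [norm g], of the quadrilateral 1, [g], [g * h ^+ i], [k]. *)
move=> tfG Hh h1 Kh; set q := (norm g + d.*2).+1.
have [i lt_i] := unbounded_powers ((norm g).*2 + q.*2) tfG h1.
have kE : g * h ^+ i = (g * h * g^-1) ^+ i * g.
  by elim: i {lt_i} => [|i IHi]; rewrite ?mulg1 ?mul1g // !expgSr mulgA IHi !mulgA mulgVK.
set k := (g * h * g^-1) ^+ i in kE.
have Kk : K k by exact: subgroupX.
have lt_q : q.*2 < norm k.
  have : norm (h ^+ i) <= norm g + (norm k + norm g).
    rewrite -(mulKg g (h ^+ i)) kE; apply: leq_trans (normM _ _ _) _.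
    by rewrite normV leq_add2l normM.
  by lia.
have [|v] := @geodesic_point _ _ _ gen_surj 1 k q; first by rewrite dist1; lia.
rewrite !dist1 => dv dvk.
have bv : btw 1 v k by rewrite /btw !dist1 dv dvk; lia.
have [||u bu le_uv] := slim_quad_far slimd bv (x' := g) (y' := g * h ^+ i).
- by right; rewrite !dist1 dv /q.
- by right; rewrite dvk kE /dist mulKg; lia.
have [K1 KM KV] := sgK; have [H1 HM HV] := sgH.
have [k' Kk' le_k'] := qcK K1 Kk bv.
have : btw (g^-1 * g) (g^-1 * u) (g^-1 * (g * h ^+ i)) by apply/btw_mul.
rewrite mulVg mulKg => /qcH[|| h' Hh' le_h']; [exact: H1 | exact: subgroupX|].
(* The factors [k'] and [h'] only conjugate the given elements inside [K] and [H]. The new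
   conjugator measures the distance from [k'] to [g * h'], both of which are near [v]. *)
exists (k'^-1 * (g * h')), (h'^-1 * h * h'); split.
- rewrite -/(dist _ _); have := dist_tri gen_surj v k' (g * h').
  have := dist_tri gen_surj u v (g * h').
  have := dist_mul gen_surj g^-1 u (g * h').
  by rewrite mulKg (dist_sym _ v u) (dist_sym _ _ h'); lia.
- by apply: (HM _ _ _ Hh'); apply: HM => //; exact: HV.
- move=> hh1; apply: h1; apply: (@mulgI _ h'^-1); apply: (@mulIg _ h').
  by rewrite hh1 mulg1 mulVg.
have -> : k'^-1 * (g * h') * (h'^-1 * h * h') * (k'^-1 * (g * h'))^-1 =
    k'^-1 * (g * h * g^-1) * k'.
  by rewrite !invgM invgK !mulgA !mulgK.
by apply: (KM _ _ _ Kk'); apply: KM => //; exact: KV.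
Qed.

(* Every vertex v_i of a geodesic from 1 to h is near H, and g v_i is near K;
   if v_i and v_j deviate in the same way, then v_i v_j^-1 h is a shorter element. *)
Lemma short_element D h g : norm g <= D -> H h -> h <> 1 -> K (g * h * g^-1) ->
  exists h', [/\ norm h' <= (size (@words X m) * size (@words X (d.*2 + D + m))).*2,
    H h', h' <> 1 & K (g * h' * g^-1)].
Proof.
move=> le_gD Hh h1 Kh.
pose P n := `[< exists h', [/\ norm h' = n, H h', h' <> 1 & K (g * h' * g^-1)] >].
have exP : exists n, P n by exists (norm h); apply/asboolP; exists h.
have [n /asboolP[{Hh h1 Kh}h [nE Hh h1 Kh]] n_min] := ex_minnP exP.
exists h; split=> //; rewrite nE leqNgt; apply/negP => lt_n.
have [K1 KM KV] := sgK; have [H1 HM HV] := sgH.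
have [v []] := geodesic_path gen_surj 1 h; rewrite dist1 nE => v0 vn vP.
set L1 := words m in lt_n; set L2 := words _ in lt_n.
have /choice[f fP] : forall i, exists ab : word X * word X, i <= n ->
    [/\ ab.1 \in L1, ab.2 \in L2, H (v i * (word_val gen ab.1)^-1) &
        K (g * v i * (word_val gen ab.2)^-1)].
  move=> i; case: (leqP i n) => [le_in|]; last by exists ([::], [::]).
  have bv : btw 1 (v i) h.
    rewrite /btw -{1}v0 -{1}vn !vP // dist1 nE; lia.
  have [u Hu le_u] := qcH H1 Hh bv; have [a a_in aE] := ball_word le_u.
  have : btw (g * 1) (g * v i) (g * h) by apply/btw_mul.
  rewrite mulg1 => bgv.
  (* The ends [g] and [g * h] are within [D] of 1 and [g * h * g^-1], which both lie in [K]. *)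
  have [||t bt le_t] := slim_quad_near slimd bgv (c := D) (x' := 1) (y' := g * h * g^-1).
  - by rewrite dist_sym dist1.
  - by rewrite /dist mulKg normV.
  have [k Kk le_k] := qcK K1 Kh bt.
  have le_kv : dist k (g * v i) <= d.*2 + D + m.
    by have := dist_tri gen_surj t k (g * v i); lia.
  have [b b_in bE] := ball_word le_kv.
  by exists (a, b) => _ /=; rewrite aE bE; split=> //; rewrite invgM invgK mulVKg.
pose L := [seq (a, b) | a <- L1, b <- L2].
have [|i [j [lt_ij lt_jn eq_f]]] := @pigeonhole _ L (size L).+1 f _ (ltnSn _).
  move=> i; rewrite size_allpairs => lt_i; have [|a_in b_in _ _] := fP i; first by lia.
  by rewrite [f i]surjective_pairing; apply: allpairs_f.
rewrite size_allpairs in lt_jn.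
have [|_ _ Hi Ki] := fP i; first by lia.
have [|_ _ Hj Kj] := fP j; first by lia.
rewrite -eq_f in Hj Kj.
have Ht : H (v i * (v j)^-1 * h).
  by have := HM _ _ (HM _ _ Hi (HV _ Hj)) Hh; rewrite !invgM invgK !mulgA mulgVK.
have Kt : K (g * (v i * (v j)^-1 * h) * g^-1).
  have := KM _ _ (KM _ _ Ki (KV _ Kj)) Kh.
  by rewrite !invgM invgK !mulgA !mulgVK.
have dvi : norm (v i) = i by rewrite -(dist1 gen_surj) -v0 vP ?subn0; lia.
have dvj : norm ((v j)^-1 * h) = n - j by rewrite -/(dist _ _) -{1}vn vP; lia.
(* Otherwise [i = n - j]. But [i < j <= size L], and the doubled bound makes [n] larger than
   [i + j]. *)
have t1 : v i * (v j)^-1 * h <> 1.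
  move=> t1; have := normV gen_surj (v i); rewrite dvi.
  have -> : (v i)^-1 = (v j)^-1 * h by apply: mulg1_eq; rewrite mulgA.
  by rewrite dvj; lia.
have le_n : n <= norm (v i * (v j)^-1 * h).
  by apply: n_min; apply/asboolP; exists (v i * (v j)^-1 * h).
have := normM gen_surj (v i) ((v j)^-1 * h); rewrite mulgA dvi dvj.
by move=> /(leq_trans le_n); lia.
Qed.

End Bounds.
End Conjugates.

(** * The decision procedure *)

Section DecisionProcedure.
Context {X : finType} {G : groupType} (gen : X -> G).
Hypothesis gen_surj : forall g, exists w, word_val gen w = g.
Notation norm := (norm gen_surj).
Notation wval := (word_val gen).

(** A classical choice. Dehn's algorithm consults it only on words of length at most [N], through
    the finite table [window_shortest]. *)
Definition shortest (w : word X) : word X := s2val (cid2 (norm_word gen_surj (wval w))).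

Lemma shortest_val w : wval (shortest w) = wval w.
Proof. by rewrite /shortest; case: cid2. Qed.

Lemma size_shortest w : size (shortest w) = norm (wval w).
Proof. by rewrite /shortest; case: cid2. Qed.

(** * Dehn's algorithm for equality in the group *)

Variables d N : nat.
Hypothesis NE : N = (d.*2.+1).*2.

(* A state of Dehn's algorithm is a stack, which holds a word in reverse order,
   and the rest of the input.  A window of at most N letters on top of the stack
   that is not geodesic is removed, and a shorter word is put back in the input. *)
Definition window_shortest (x : word X) : word X :=
  if x \in @words X N then shortest (rev x) else [::].

Definition dehn_step (st : word X * word X) : word X * word X :=
  if st.2 is a :: r then
    if size (take N (a :: st.1)) <= size (window_shortest (take N (a :: st.1)))
    then (a :: st.1, r)
    else (drop N (a :: st.1), window_shortest (take N (a :: st.1)) ++ r)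
  else st.

(** The number of steps is the initial value of [dehn_measure], which decreases as long as input
    remains. *)
Definition dehn (w : word X) : word X := (iter (N.+1 * size w) dehn_step ([::], w)).1.

Definition locally_geodesic s := forall i,
  size (take N (drop i s)) = norm (wval (rev (take N (drop i s)))).

Lemma window_shortestE s : window_shortest (take N s) = shortest (rev (take N s)).
Proof. by rewrite /window_shortest mem_words size_take_min geq_minl. Qed.

Lemma dehn_step_cons s a r (x := take N (a :: s)) :
  dehn_step (s, a :: r) = if size x <= norm (wval (rev x)) then (a :: s, r)
                          else (drop N (a :: s), shortest (rev x) ++ r).
Proof. by rewrite /dehn_step /x -size_shortest -window_shortestE. Qed.

Lemma dehn_step_val st :
  wval (rev (dehn_step st).1) * wval (dehn_step st).2 = wval (rev st.1) * wval st.2.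
Proof.
case: st => s [|a r] //; rewrite dehn_step_cons.
have asE : wval (rev (a :: s)) * wval r = wval (rev s) * wval (a :: r).
  by rewrite rev_cons -cats1 word_val_cat !word_val_cons word_val_nil mulg1 mulgA.
case: leqP => _; rewrite [(_, _).2]/= [(_, _).1]/= //.
rewrite -asE word_val_cat shortest_val mulgA; congr (_ * _).
by rewrite -word_val_cat -rev_cat cat_take_drop.
Qed.

Lemma dehn_step_geodesic st : locally_geodesic st.1 -> locally_geodesic (dehn_step st).1.
Proof.
case: st => s [|a r] // geo_s; rewrite dehn_step_cons.
case: leqP => [le_x | _] i; rewrite [(_, _).1]/=; last first.
  rewrite drop_drop (_ : i + N = (i + N.-1).+1); first exact: geo_s.
  by lia.
case: i => [|i]; last exact: geo_s.
rewrite drop0; apply/eqP; rewrite eqn_leq le_x /=.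
by rewrite -(size_rev (take N _)) norm_val.
Qed.

(** Pushing a letter lowers its weight from [N + 1] to [N]. Replacing a window returns at most
    [N - 1] stack letters to the input, a gain of 1 each, and shortens the word by at least one
    letter, a loss of [N + 1]. *)
Definition dehn_measure (st : word X * word X) := N * size st.1 + N.+1 * size st.2.

Lemma dehn_step_measure s a r :
  dehn_measure (dehn_step (s, a :: r)) < dehn_measure (s, a :: r).
Proof.
rewrite dehn_step_cons /dehn_measure; case: ifP => [_|/negbT] /=; first by nia.
rewrite -ltnNge => lt_x.
rewrite size_cat size_shortest size_drop.
have : size (take N (a :: s)) = minn N (size s).+1 by rewrite size_take_min.
rewrite /=; case: leqP; rewrite /= => ? ?; nia.
Qed.

Lemma dehn_iter_end n st : dehn_measure st <= n -> (iter n dehn_step st).2 = [::].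
Proof.
elim: n st => [|n IHn] [s [|a r]] le_n //.
- by rewrite /dehn_measure /= in le_n; lia.
- by rewrite (_ : iter _ _ _ = (s, [::])) //; elim: (n.+1) => //= k ->.
by rewrite iterSr IHn // -ltnS (leq_trans (dehn_step_measure _ _ _)).
Qed.

Variable slimd : forall x y z v, btw gen_surj x v y ->
  exists2 u, btw gen_surj x u z \/ btw gen_surj z u y & dist gen_surj u v <= d.

Lemma locally_geodesic_trivial s : locally_geodesic s -> wval (rev s) = 1 -> s = [::].
Proof.
move=> geo_s s1; apply: size0nil.
pose p i := wval (rev (drop i s)).
apply: (closed_local_geodesic slimd (p := p)); first by rewrite /p drop0.
  by rewrite /p drop_size word_val_nil.
move=> i j le_ij le_js; rewrite -NE => le_ijN.
have pE : p i = p j * wval (rev (take (j - i) (drop i s))).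
  by rewrite /p -word_val_cat -rev_cat -{1}(cat_take_drop (j - i) (drop i s)) drop_drop subnK.
rewrite dist_sym /dist pE mulKg.
have sizeE : size (rev (take N (drop i s))) = norm (wval (rev (take N (drop i s)))).
  by rewrite size_rev.
rewrite -(cat_take_drop (j - i) (take N (drop i s))) rev_cat in sizeE.
have [_] := geodesic_cat sizeE; rewrite take_takel // => <-.
by rewrite size_rev size_takel // size_drop leq_sub2r.
Qed.

Lemma dehn_nil w : (dehn w == [::]) = (wval w == 1).
Proof.
rewrite /dehn; set st := iter _ _ _.
have geo_st : locally_geodesic st.1.
  rewrite /st; elim: (_ * _)%N => [i|n IHn]; last exact: dehn_step_geodesic.
  by rewrite word_val_nil norm1.
have st_val : wval (rev st.1) * wval st.2 = wval w.
  rewrite /st; elim: (_ * _)%N => [|n IHn]; first by rewrite word_val_nil mul1g.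
  by rewrite iterS dehn_step_val.
rewrite dehn_iter_end ?word_val_nil ?mulg1 in st_val; last first.
  by rewrite /dehn_measure muln0.
rewrite -st_val; apply/eqP/eqP => [->|]; first by rewrite word_val_nil.
exact: locally_geodesic_trivial.
Qed.

Definition eqw (u v : word X) := dehn (u ++ word_inv v) == [::].

Lemma eqwE u v : eqw u v = (wval u == wval v).
Proof. by rewrite /eqw dehn_nil word_val_cat word_val_inv divg_eq1. Qed.

Lemma computable_window_shortest : computable window_shortest.
Proof. exact: computable_finite_support (@word_en_inj X). Qed.

Lemma computable_dehn_step : computable dehn_step.
Proof.
rewrite /dehn_step; apply: computable_seq_case; [by seq_computability | by seq_computability|].
have cw : computable (fun p : (word X * word X) * (letter X * word X) => take N (p.2.1 :: p.1.1)).
  by seq_computability.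
have cs := computable_app computable_window_shortest cw.
apply: computable_if; first by apply: (computable_rel2 recursive_leq); apply: computable_size.
  by seq_computability.
apply: computable_pair; first by seq_computability.
by apply: computable_cat; [exact: cs | seq_computability].
Qed.

Lemma computable_dehn : computable dehn.
Proof.
rewrite /dehn; seq_computability.
apply: (computable_iter (s := fun=> dehn_step)); [by seq_computability | by seq_computability |].
by apply: (computable_app computable_dehn_step); seq_computability.
Qed.

Lemma computable_word_inv : computable (@word_inv X).
Proof.
(* Inversion of letters is a finite table; its values are wrapped into words to have a default value
   even if the alphabet is empty. *)
pose inv1 (a : letter X) : word X := if a \in enum {: X * bool} then [:: letter_inv a] else [::].
have ci : computable inv1 by exact: computable_finite_support (@letter_code_inj X).
have : computable (fun w : word X => rev (flatten [seq inv1 a | a <- w])).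
  by seq_computability; apply: (computable_app ci); seq_computability.
apply: computable_ext => w; congr rev; elim: w => //= a w ->.
by rewrite /inv1 mem_enum.
Qed.

Lemma computable_eqw : computable (fun p : word X * word X => eqw p.1 p.2).
Proof.
have c1 : computable (fun w : word X => size (dehn w) <= 0).
  apply: (computable_rel2 recursive_leq); last by seq_computability.
  exact: computable_size computable_dehn.
have c2 : computable (fun p : word X * word X => p.1 ++ word_inv p.2).
  by seq_computability; apply: (computable_app computable_word_inv); seq_computability.
have := computable_app c1 c2; apply: computable_ext => p.
by rewrite leqn0 size_eq0.
Qed.


(** * Local certificates for membership in a subgroup *)

Definition gens (A : seq (word X)) : seq (word X) := A ++ [seq word_inv a | a <- A].

Definition products (A : seq (word X)) t : seq (word X) :=
  iter t (fun P => P ++ flatten [seq [seq x ++ y | y <- gens A] | x <- P]) [:: [::]].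

Definition is_product A t w := has (eqw w) (products A t).

Definition is_short r w := has (eqw w) (@words X r).

Definition is_geodesic w := all (fun z => eqw w z ==> (size w <= size z)) (@words X (size w)).

(* The finitely many conditions of the local certificate; q is the radius up to
   which quasiconvexity is tested. *)
Definition locally_complete m q r A t :=
  [&& all (is_product A t) A,
      all (fun x => is_product A t x ==> is_product A t (word_inv x)) (@words X r),
      all (fun x => all (fun y => [&& is_product A t x, is_product A t y & is_short r (x ++ y)]
        ==> is_product A t (x ++ y)) (@words X r)) (@words X r)
    & all (fun x => all (fun y =>
        [&& is_product A t (x ++ y), is_geodesic (x ++ y) & is_short q (x ++ y)] ==>
        has (fun z => is_product A t (x ++ z)) (@words X m)) (@words X q)) (@words X q)].

Ltac word_computability_step := eta_computable;
  lazymatch goal with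
  | |- computable (fun x => eqw _ _) => apply: (computable_app2 computable_eqw)
  | |- computable (fun x => word_inv _) => apply: (computable_app computable_word_inv)
  | |- computable (fun x => words _) => apply: (computable_app computable_words)
  | |- computable (fun x => iter _ _ _) => apply: computable_iter
  | |- _ => seq_computability_step
  end.
Ltac word_computability := repeat word_computability_step.

Lemma computable_products : computable (fun p : seq (word X) * nat => products p.1 p.2).
Proof. by rewrite /products /gens; word_computability. Qed.

Lemma computable_is_product :
  computable (fun p : seq (word X) * (nat * word X) => is_product p.1 p.2.1 p.2.2).
Proof.
rewrite /is_product; word_computability.
by apply: (computable_app2 computable_products); word_computability.
Qed.


Lemma is_productP A t w :
  reflect (exists2 x, x \in products A t & wval x = wval w) (is_product A t w).
Proof.
apply: (iffP hasP) => -[x xP]; first by rewrite eqwE => /eqP E; exists x.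
by move=> E; exists x; rewrite ?eqwE ?E.
Qed.

Lemma is_shortE r w : is_short r w = (norm (wval w) <= r).
Proof.
apply/hasP/idP => [[x] | /ball_word[x x_in xE]]; last by exists x; rewrite ?eqwE ?xE.
by rewrite mem_words eqwE => le_xr /eqP ->; exact: leq_trans (norm_val _ _) le_xr.
Qed.

Lemma is_geodesicE w : is_geodesic w = (size w == norm (wval w)).
Proof.
apply/allP/eqP => [geo_w | size_w z _]; last first.
  by apply/implyP; rewrite eqwE => /eqP eq_wz; rewrite size_w eq_wz norm_val.
apply/eqP; rewrite eqn_leq norm_val andbT.
have [x xE size_x] := norm_word gen_surj (wval w).
rewrite -size_x; apply: (implyP (geo_w x _)); last by rewrite eqwE xE.
by rewrite mem_words size_x norm_val.
Qed.

Lemma products_sub A t t' : t <= t' -> {subset products A t <= products A t'}.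
Proof.
move=> /subnK <-; elim: (t' - t) => // k IHk x /IHk.
by rewrite addSn /= mem_cat => ->.
Qed.

Lemma products_flatten A (l : seq (word X)) : {subset l <= gens A} ->
  flatten l \in products A (size l).
Proof.
elim/last_ind: l => [|l a IHl] lA; first exact: mem_head.
rewrite size_rcons flatten_rcons /= mem_cat; apply/orP; right.
have lA' : {subset l <= gens A} by move=> x xl; apply: lA; rewrite mem_rcons inE xl orbT.
apply/flatten_mapP; exists (flatten l); first exact: IHl.
by apply: map_f; apply: lA; rewrite mem_rcons mem_head.
Qed.

Section Subgroup.
Variable A : seq (word X).
Notation H := (subgroup_gen gen A).

Lemma subgroup_gen_subgroup : is_subgroup H.
Proof.
split=> [L [[L1 LM LV] AL] // | x y Hx Hy L LP | x Hx L LP].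
  by case: (LP) => -[_ LM _] _; apply: LM; [exact: Hx LP | exact: Hy LP].
by case: (LP) => -[_ _ LV] _; apply: LV; exact: Hx LP.
Qed.

Lemma subgroup_gen_mem a : a \in A -> H (wval a).
Proof. by move=> aA L [_ AL]; apply: AL; exists a. Qed.

Lemma subgroup_gen_products t x : x \in products A t -> H (wval x).
Proof.
have [H1 HM HV] := subgroup_gen_subgroup.
elim: t x => [|t IHt] x /=; first by rewrite inE => /eqP ->; rewrite word_val_nil.
rewrite mem_cat => /orP[/IHt // | /flatten_mapP[y /IHt Hy /mapP[a aA ->]]].
rewrite word_val_cat; apply: HM => //.
move: aA; rewrite mem_cat => /orP[/subgroup_gen_mem // | /mapP[b /subgroup_gen_mem Hb ->]].
by rewrite word_val_inv; exact: HV.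
Qed.

Lemma subgroup_gen_flatten g : H g ->
  exists2 l : seq (word X), {subset l <= gens A} & wval (flatten l) = g.
Proof.
pose L : set G := [set h | exists2 l : seq (word X), {subset l <= gens A} &
  wval (flatten l) = h]%classic.
move=> Hg; apply: (Hg L); rewrite /L {L}.
split=> [|_ [a aA <-]]; last first.
  exists [:: a]; last by rewrite /= cats0.
  by move=> _ /[!inE] /eqP ->; rewrite mem_cat aA.
split.
- by exists [::]; rewrite ?word_val_nil.
- move=> _ _ [l lA <-] [k kA <-]; exists (l ++ k); last by rewrite flatten_cat word_val_cat.
  by move=> x; rewrite mem_cat => /orP[/lA | /kA].
move=> _ [l lA <-].
suff [k kA kE] : exists2 k, {subset k <= gens A} & wval (flatten k) = (wval (flatten l))^-1.
  by exists k.
elim: l lA => [|a l IHl] lA; first by exists [::]; rewrite // word_val_nil invg1.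
have [|k kA kE] := IHl; first by move=> x xl; apply: lA; rewrite inE xl orbT.
have : a \in gens A by apply: lA; exact: mem_head.
rewrite /= word_val_cat invgM -kE mem_cat => aP.
have [b bA bE] : exists2 b, b \in gens A & wval b = (wval a)^-1.
  case/orP: aP => [aA | /mapP[b bA ->]].
    by exists (word_inv a); rewrite ?word_val_inv // mem_cat map_f ?orbT.
  by exists b; rewrite ?word_val_inv ?invgK // mem_cat bA.
exists (rcons k b); first by move=> x; rewrite mem_rcons inE => /orP[/eqP -> | /kA].
by rewrite flatten_rcons word_val_cat bE.
Qed.

(** Only finitely many words have length at most [r]; the numbers of factors they require are added
    up along the list. Membership is decided classically here: the bound only guarantees that a
    search ends. *)
Lemma is_product_eventually r : exists t0, forall t w, t0 <= t ->
  norm (wval w) <= r -> H (wval w) -> is_product A t w.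
Proof.
have [t0 t0P] : exists t0, forall w, w \in @words X r -> H (wval w) -> is_product A t0 w.
  elim: (words r) => [|w s [t1 IHs]]; first by exists 0%N.
  have [Hw | nHw] := pselect (H (wval w)); last first.
    by exists t1 => x /[!inE] /orP[/eqP -> // | /IHs].
  have [l lA lE] := subgroup_gen_flatten Hw.
  exists (t1 + size l)%N => x; rewrite inE => /orP[/eqP -> _ | xs Hx].
    apply/is_productP; exists (flatten l) => //.
    exact: products_sub (leq_addl _ _) _ (products_flatten lA).
  have /is_productP[y yP yE] := IHs x xs Hx.
  by apply/is_productP; exists y => //; exact: products_sub (leq_addr _ _) _ yP.
exists t0 => t w le_t le_wr Hw; have [x x_in xE] := ball_word le_wr.
rewrite -xE in Hw; have /is_productP[y yP yE] := t0P x x_in Hw.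
by apply/is_productP; exists y; rewrite ?yE //; exact: products_sub le_t _ yP.
Qed.

Lemma is_product_mem t w : is_product A t w -> H (wval w).
Proof. by case/is_productP => x /subgroup_gen_products Hx <-. Qed.

Lemma locally_complete_eventually m q r : metric_quasiconvex gen_surj m H ->
  q + m <= r -> (forall a, a \in A -> size a <= r) ->
  exists t0, forall t, t0 <= t -> locally_complete m q r A t.
Proof.
move=> qcH le_qr le_Ar; have [H1 HM HV] := subgroup_gen_subgroup.
have [t0 t0P] := is_product_eventually r; exists t0 => t le_t.
have prod_in w := t0P t w le_t; apply/and4P; split; apply/allP => x.
- by move=> xA; apply: prod_in (subgroup_gen_mem xA); exact: leq_trans (norm_val _ _) (le_Ar x xA).
- rewrite mem_words => le_xr; apply/implyP => /is_product_mem Hx.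
  apply: prod_in; last by rewrite word_val_inv; exact: HV.
  by apply: leq_trans (norm_val _ _) _; rewrite size_word_inv.
- move=> _; apply/allP => y _; apply/implyP => /and3P[/is_product_mem Hx /is_product_mem Hy].
  rewrite is_shortE => le_xy; apply: prod_in => //.
  by rewrite word_val_cat; exact: HM.
move=> _; apply/allP => y _; apply/implyP => /and3P[/is_product_mem Hxy].
rewrite is_geodesicE is_shortE => /eqP geo_xy le_xy.
have bx : btw gen_surj 1 (wval x) (wval (x ++ y)).
  have [geo_x geo_y] := geodesic_cat geo_xy.
  rewrite /btw !dist1 -geo_xy -geo_x size_cat geo_y; congr (_ + norm _).
  by rewrite word_val_cat mulKg.
have [u Hu le_u] := qcH _ _ _ H1 Hxy bx.
rewrite dist_sym in le_u; have [z z_in zE] := ball_word le_u.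
have xzE : wval (x ++ z) = u by rewrite word_val_cat zE mulVKg.
apply/hasP; exists z => //; apply: prod_in; rewrite xzE //.
have := dist_tri gen_surj (wval x) 1 u; rewrite !dist1.
have := geodesic_cat geo_xy; rewrite -geo_xy size_cat in le_xy; lia.
Qed.

Lemma locally_complete_sound m m1 m2 w c q r t :
  m1 = m + d.*2 -> m2 = m1 + c.*2 + d.*2 -> w = m2 + d.*2.+1 -> q = w.*2 + m2.*2 ->
  q + m <= r -> (forall a, a \in A -> size a <= c) -> locally_complete m q r A t ->
  forall x, H (wval x) -> norm (wval x) + m1.*2 <= r -> is_product A t x.
Proof.
move=> m1E m2E wE qE le_qr le_Ac /and4P[/allP okA /allP okV /allP okM /allP okqc] x Hx le_x.
(* Cutting [S] down to the ball of radius [r] lets the tests, which range over words of length at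
   most [r], speak about all of [S]. *)
pose S g := norm g <= r /\ exists2 y, y \in products A t & wval y = g.
have Sx y : is_product A t y -> norm (wval y) <= r -> S (wval y).
  by move=> /is_productP yP le_y.
have xS y : S (wval y) -> is_product A t y by case=> _ yP; apply/is_productP.
have wordS g : S g -> exists y, [/\ y \in @words X r, is_product A t y & wval y = g].
  case=> le_g gP; have [y y_in yE] := ball_word le_g; exists y; split=> //.
  by apply/is_productP; rewrite yE.
have S1 : S 1.
  split; first by rewrite norm1.
  exists [::]; last exact: word_val_nil.
  by apply: (products_sub (leq0n t)); exact: mem_head.
have SV g : S g -> S g^-1.
  move=> Sg; have [y [y_in yP yE]] := wordS g Sg.
  have := implyP (okV y y_in) yP; rewrite -yE -word_val_inv => /Sx; apply.
  by rewrite word_val_inv normV yE; case: Sg.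
have SM g h : S g -> S h -> norm (g * h) <= r -> S (g * h).
  move=> /wordS[y [y_in yP <-]] /wordS[z [z_in zP <-]]; rewrite -word_val_cat => le_yz.
  by apply: Sx => //; apply: (implyP (allP (okM y y_in) z z_in)); rewrite yP zP is_shortE.
have Sqc g v : S g -> norm g <= w.*2 + m2.*2 -> btw gen_surj 1 v g ->
    exists2 u, S u & dist gen_surj u v <= m.
  rewrite -qE => Sg le_gq bv.
  have [y yE size_y] := norm_word gen_surj v; have [z zE size_z] := norm_word gen_surj (v^-1 * g).
  have yzE : wval (y ++ z) = g by rewrite word_val_cat yE zE mulVKg.
  have size_yz : size (y ++ z) = norm g.
    by rewrite size_cat size_y size_z; move: bv; rewrite /btw !dist1.
  have y_in : y \in @words X q by rewrite mem_words; rewrite size_cat in size_yz; lia.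
  have z_in : z \in @words X q by rewrite mem_words; rewrite size_cat in size_yz; lia.
  have := allP (okqc y y_in) z z_in.
  rewrite is_shortE is_geodesicE yzE le_gq size_yz eqxx (xS (y ++ z)) ?yzE //= => /hasP[s].
  rewrite mem_words => le_sm ysP; exists (wval (y ++ s)).
    apply: Sx => //; rewrite word_val_cat; apply: leq_trans (normM _ _ _) _.
    by have := norm_val gen_surj s; rewrite yE -size_y; rewrite size_cat in size_yz; lia.
  rewrite dist_sym /dist word_val_cat -yE mulKg.
  exact: leq_trans (norm_val _ _) le_sm.
have [l lA lE] := subgroup_gen_flatten Hx; apply: xS; rewrite -lE.
have le_r : w.*2 + m2.*2 <= r by lia.
apply: (chain_mem m1E m2E wE le_r S1 SM); last by rewrite lE.
(* Generators are appended on the right one at a time; the intermediate products may be arbitrarily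
   long, since a chain exists at any length. *)
elim/last_ind: l lA {lE} => [|l a IHl] lA.
  by rewrite word_val_nil; exact: chain1.
rewrite flatten_rcons word_val_cat.
have SA b : b \in A -> S (wval b) /\ norm (wval b) <= c.
  move=> bA; have le_b : norm (wval b) <= c.
    exact: leq_trans (norm_val _ _) (le_Ac b bA).
  by split=> //; apply: Sx; [exact: okA | lia].
have [Sa le_a] : S (wval a) /\ norm (wval a) <= c.
  have : a \in gens A by apply: lA; rewrite mem_rcons mem_head.
  rewrite mem_cat => /orP[/SA // | /mapP[b /SA[Sb le_b] ->]].
  by rewrite word_val_inv normV; split=> //; exact: SV.
apply: (chain_mul slimd m1E m2E wE le_r S1 SV SM Sqc) Sa le_a.
by apply: IHl => y yl; apply: lA; rewrite mem_rcons inE yl orbT.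
Qed.

End Subgroup.

(** * The explicit radii and the search *)

Definition lengths_bound (q : nat * (seq (word X) * seq (word X))) :=
  size (flatten q.2.1 ++ flatten q.2.2).

(** These are [m2] and [q] of [locally_complete_sound]; the bound [c] on generators will be the
    total length of all given words. *)
Definition chain_width m c := m + d.*2 + c.*2 + d.*2.

Definition local_radius m c :=
  (chain_width m c + d.*2.+1).*2 + (chain_width m c).*2.

(** The bound of [short_conjugator]; it becomes [D] in the bound of [short_element], which is
    [elt_radius]. *)
Definition conj_radius m := m.*2 + d.*2.

Definition elt_radius m :=
  (size (@words X m) * size (@words X (d.*2 + conj_radius m + m))).*2.

(** The first two terms serve the quasiconvexity test, the next two cover [h] and [g * h * g^-1],
    and the last is the margin [2 m1] of [locally_complete_sound]. *)
Definition product_radius m c :=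
  local_radius m c + m + elt_radius m + (conj_radius m).*2 + (m + d.*2).*2.

Definition certified (q : nat * (seq (word X) * seq (word X))) t :=
  locally_complete q.1 (local_radius q.1 (lengths_bound q))
    (product_radius q.1 (lengths_bound q)) q.2.1 t &&
  locally_complete q.1 (local_radius q.1 (lengths_bound q))
    (product_radius q.1 (lengths_bound q)) q.2.2 t.

Definition conjugate_found (q : nat * (seq (word X) * seq (word X))) t :=
  has (fun h => has (fun g => [&& is_product q.2.1 t h, ~~ eqw h [::]
      & is_product q.2.2 t (g ++ h ++ word_inv g)])
    (@words X (conj_radius q.1))) (@words X (elt_radius q.1)).

Lemma computable_double : computable double.
Proof. by exists double; first exact: recursive_double. Qed.

Ltac product_computability_step := eta_computable;
  lazymatch goal with
  | |- computable (fun x => is_product _ _ _) =>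
      apply: (computable_app3 computable_is_product)
  | |- computable (fun x => double _) => apply: (computable_app computable_double)
  | |- _ => word_computability_step
  end.
Ltac product_computability := repeat product_computability_step.

Lemma computable_locally_complete :
  computable (fun p : (nat * (nat * nat)) * (seq (word X) * nat) =>
    locally_complete p.1.1 p.1.2.1 p.1.2.2 p.2.1 p.2.2).
Proof.
rewrite /locally_complete /is_geodesic /is_short; product_computability.
Qed.

Lemma computable_local_radius : computable (fun p : nat * nat => local_radius p.1 p.2).
Proof. by rewrite /local_radius /chain_width; product_computability. Qed.

Lemma computable_elt_radius : computable elt_radius.
Proof. by rewrite /elt_radius /conj_radius; product_computability. Qed.

Lemma computable_product_radius : computable (fun p : nat * nat => product_radius p.1 p.2).
Proof.
rewrite /product_radius /conj_radius; product_computability.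
  by apply: (computable_app2 computable_local_radius); product_computability.
by apply: (computable_app computable_elt_radius); product_computability.
Qed.

Lemma computable_certified :
  computable (fun p : (nat * (seq (word X) * seq (word X))) * nat => certified p.1 p.2).
Proof.
have lb : computable lengths_bound by rewrite /lengths_bound; product_computability.
have complete (f : (nat * (seq (word X) * seq (word X))) * nat -> seq (word X)) :
    computable f -> computable (fun p : (nat * (seq (word X) * seq (word X))) * nat =>
      locally_complete p.1.1 (local_radius p.1.1 (lengths_bound p.1))
        (product_radius p.1.1 (lengths_bound p.1)) (f p) p.2).
  move=> cf; pose args (p : (nat * (seq (word X) * seq (word X))) * nat) :=
    ((p.1.1, (local_radius p.1.1 (lengths_bound p.1),
              product_radius p.1.1 (lengths_bound p.1))), (f p, p.2)).
  apply: (computable_app computable_locally_complete (g := args)).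
  rewrite /args; product_computability => //.
  - apply: (computable_app2 computable_local_radius); product_computability.
    by apply: (computable_app lb); product_computability.
  - apply: (computable_app2 computable_product_radius); product_computability.
    by apply: (computable_app lb); product_computability.
rewrite /certified; apply: computable_and; apply: complete; product_computability.
Qed.

Lemma computable_conjugate_found :
  computable (fun p : (nat * (seq (word X) * seq (word X))) * nat => conjugate_found p.1 p.2).
Proof.
rewrite /conjugate_found /conj_radius; product_computability.
by apply: (computable_app computable_elt_radius); product_computability.
Qed.

Section Decision.
Variables (m : nat) (A B : seq (word X)).
Let q := (m, (A, B)).
Notation H := (subgroup_gen gen A).
Notation K := (subgroup_gen gen B).

Lemma size_lengths_bound a : (a \in A) || (a \in B) -> size a <= lengths_bound q.
Proof.
have size_flatten_mem (L : seq (word X)) : a \in L -> size a <= size (flatten L).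
  elim: L => // b L IHL; rewrite inE /= size_cat => /orP[/eqP -> | /IHL]; first exact: leq_addr.
  by move/leq_trans; apply; exact: leq_addl.
rewrite /lengths_bound size_cat => /orP[] /size_flatten_mem /leq_trans; apply.
  exact: leq_addr.
exact: leq_addl.
Qed.

(** Each certificate holds for all large [t], so one [t] serves both subgroups. *)
Lemma certified_exists : metric_quasiconvex gen_surj m H -> metric_quasiconvex gen_surj m K ->
  exists t, certified q t.
Proof.
move=> qcH qcK; have le_qr : local_radius m (lengths_bound q) + m <=
    product_radius m (lengths_bound q) by rewrite /product_radius; lia.
have le_cr : lengths_bound q <= product_radius m (lengths_bound q).
  rewrite /product_radius /local_radius /chain_width; move: (lengths_bound q) => c; lia.
have [|tA tAP] := locally_complete_eventually qcH le_qr.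
  by move=> a aA; apply: leq_trans le_cr; apply: size_lengths_bound; rewrite aA.
have [|tB tBP] := locally_complete_eventually qcK le_qr.
  by move=> a aB; apply: leq_trans le_cr; apply: size_lengths_bound; rewrite aB orbT.
by exists (tA + tB)%N; rewrite /certified tAP ?tBP ?leq_addl ?leq_addr.
Qed.

Lemma certified_sound t : certified q t -> forall x,
  norm (wval x) <= elt_radius m + (conj_radius m).*2 ->
  (H (wval x) -> is_product A t x) /\ (K (wval x) -> is_product B t x).
Proof.
move=> /andP[okA okB] x le_x.
have le_qr : local_radius m (lengths_bound q) + m <=
    product_radius m (lengths_bound q) by rewrite /product_radius; lia.
have le_xr : norm (wval x) + (m + d.*2).*2 <= product_radius m (lengths_bound q).
  by rewrite /product_radius; lia.
split=> [Hx|Kx].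
  apply: (locally_complete_sound erefl erefl erefl erefl le_qr _ okA Hx le_xr).
  by move=> a aA; apply: size_lengths_bound; rewrite aA.
apply: (locally_complete_sound erefl erefl erefl erefl le_qr _ okB Kx le_xr).
by move=> a aB; apply: size_lengths_bound; rewrite aB orbT.
Qed.

(** A success exhibits actual elements. Conversely, the two bounds bring a solution into the finite
    range of the search, and the certificates make [is_product] recognize its memberships. *)
Lemma conjugate_foundP t : torsion_free G ->
  metric_quasiconvex gen_surj m H -> metric_quasiconvex gen_surj m K ->
  certified q t ->
  conjugate_found q t <-> exists h g : G, [/\ H h, h <> 1 & K (g * h * g^-1)].
Proof.
move=> tfG qcH qcK cert; split.
  case/hasP => h _ /hasP[g _ /and3P[/is_product_mem Hh h1 /is_product_mem]].
  rewrite !word_val_cat word_val_inv mulgA => Kh.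
  by exists (wval h), (wval g); split=> //; apply/eqP; rewrite eqwE word_val_nil in h1.
have sgA := subgroup_gen_subgroup A; have sgB := subgroup_gen_subgroup B.
case=> h0 [g0 [Hh0 h01 Kh0]].
have [g [h1 [le_g Hh1 h11 Kh1]]] := short_conjugator slimd sgA sgB qcH qcK tfG Hh0 h01 Kh0.
have [h [le_h Hh hneq1 Kh]] := short_element slimd sgA sgB qcH qcK le_g Hh1 h11 Kh1.
have [x x_in xE] := ball_word le_h; have [y y_in yE] := ball_word le_g.
apply/hasP; exists x => //; apply/hasP; exists y => //.
rewrite -xE in Hh le_h; apply/and3P; split.
- by apply: (certified_sound cert _).1 Hh; rewrite (leq_trans le_h) // leq_addr.
- by rewrite eqwE word_val_nil xE; apply/eqP.
have E : wval (y ++ x ++ word_inv y) = g * h * g^-1.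
  by rewrite !word_val_cat word_val_inv xE yE mulgA.
apply: (certified_sound cert _).2; rewrite E //.
apply: leq_trans (normM _ _ _) _; rewrite normV.
have := normM gen_surj g h; rewrite -xE; move: le_h le_g.
by rewrite /elt_radius /conj_radius; lia.
Qed.

End Decision.

End DecisionProcedure.

(** As [q >= 1], the numerator bounds the fraction and provides an integer constant for the
    algorithm. *)
Lemma quasiconvex_metric (X : finType) (G : groupType) (gen : X -> G)
    (gen_surj : forall g, exists w, word_val gen w = g) (R : realType)
    (p q : nat) (H : set G) : (0 < q)%N ->
  quasiconvex gen (p%:R / q%:R : R)%R H -> metric_quasiconvex gen_surj p H.
Proof.
move=> q_gt0 qc x y v Hx Hy bv.
have [a aE size_a] := norm_word gen_surj (x^-1 * v).
have [b bE size_b] := norm_word gen_surj (v^-1 * y).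
have abE : word_val gen (a ++ b) = x^-1 * y by rewrite word_val_cat aE bE mulgA mulgK.
have geo_ab : geodesic gen x (a ++ b).
  by apply/(geodesicP gen_surj); rewrite abE size_cat size_a size_b.
have [||w] := qc x (a ++ b) geo_ab Hx _ v; rewrite ?path_endE ?abE ?mulVKg //.
  by apply/mem_path_vertices; exists a, b; rewrite aE mulVKg.
case=> Hu le_w; exists (v * word_val gen w) => //.
rewrite dist_sym /dist mulKg (leq_trans (norm_val _ _)) //.
rewrite -(ler_nat R) (le_trans le_w) // ler_pdivrMr ?ltr0n //.
by rewrite ler_peMr ?ler0n // ler1n.
Qed.

Theorem theorem1 (X : finType) (G : groupType) (gen : X -> G)
    (rels : set (word X)) (R : realType) (delta : R)
    (hpres : is_presentation gen rels)
    (htf : torsion_free G)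
    (hcurv : negatively_curved gen delta) :
  exists f : recfun 4,
  forall (p q : nat) (A B : seq (word X)),
    let mu : R := (p%:R / q%:R)%R in
    let H := subgroup_gen gen A in
    let K := subgroup_gen gen B in
    (0 < q)%N -> quasiconvex gen mu H -> quasiconvex gen mu K ->
    exists b : bool,
      rec_eval f [tuple p; q; words_code A; words_code B] b /\
      (b <-> exists h g : G, [/\ H h, h <> 1%g & K (g * h * g^-1)%g]).
Proof.
have [gen_surj _] := hpres.
(* An integer above [delta] is fixed with the group, before any input is read, and is built into the
   algorithm. *)
pose d := Num.bound `|delta|%R.
have le_d : (delta <= d%:R)%R.
  by apply: le_trans (ler_norm _) _; apply: ltW; apply: archi_boundP.
have slimd := slim (gen_surj := gen_surj) hcurv le_d.
have [f fP] := recursive_search (computable_certified gen_surj d (d.*2.+1).*2)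
  (computable_conjugate_found gen_surj d (d.*2.+1).*2).
have [pr prE] := recursive_natpair.
(* The arguments 0, 2 and 3 are packed into the code of [(p, (A, B))], with [p] as the
   quasiconvexity constant. *)
exists (RComp f (fun=> RComp pr (tnth [tuple @projn 4 0 isT;
  RComp pr (tnth [tuple @projn 4 2 isT; @projn 4 3 isT])]))).
move=> p q A B mu H K q_gt0 qcH qcK.
have {}qcH := quasiconvex_metric (gen_surj := gen_surj) q_gt0 qcH.
have {}qcK := quasiconvex_metric (gen_surj := gen_surj) q_gt0 qcK.
have [t cert ft] := fP (p, (A, B)) (certified_exists erefl slimd qcH qcK).
exists (conjugate_found gen_surj d (d.*2.+1).*2 (p, (A, B)) t); split; last first.
  exact: conjugate_foundP.
apply: rec_comp1 ft; apply: rec_comp2 (prE _ _); first exact: rec_proj.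
by apply: rec_comp2 (prE _ _); exact: rec_proj.
Qed.
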